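(* Let $n\ge 5$, and let $\mathbb{T}_n$ be the two-dimensional discrete torus graph with edge set $E_n$, cycle space $Z_n$ and cut space $B_n$. The collection of all $\Gamma_n$-invariant projections $P$ on $\mathbb{R}^{E_n}$ with range $Z_n$ is parameterized by the linear space of $\Gamma_n$-invariant linear mappings $A:B_n\to Z_n$ (the projection corresponding to $A$ being $P(z+b)=z+A(b)$ for $z\in Z_n$, $b\in B_n$), and this linear space has dimension $\lfloor n/2\rfloor(\lfloor n/2\rfloor-1)/2$.
   Context: $\mathbb{T}_n=\mathbb{Z}_n\times\mathbb{Z}_n$ is the graph with vertices $(i,j)$, $i,j\in\mathbb{Z}_n$, and oriented edges $(i,j)\to(i+1,j)$ and $(i,j)\to(i,j+1)$ (addition mod $n$). The cycle space is $Z_n=\{F\in\mathbb{R}^{E_n}:\ \sum_{e^+=v}F(e)=\sum_{e^-=v}F(e)\text{ for all vertices }v\}$, where $e^-$ and $e^+$ are the tail and head of $e$; the cut space $B_n$ is the orthogonal complement of $Z_n$ in $\mathbb{R}^{E_n}$ for the standard inner product, so $\mathbb{R}^{E_n}=Z_n\oplus B_n$. $\Gamma_n$ is the group of linear isometries of $\ell_1(E_n)$ (i.e. $\mathbb{R}^{E_n}$ with the $\ell_1$-norm) that leave $Z_n$ invariant; such isometries are signed permutations of the edge basis, hence also leave $B_n$ invariant. A projection $P$ is $\Gamma_n$-invariant if $Pg=gP$ for all $g\in\Gamma_n$; a linear map $A:B_n\to Z_n$ is $\Gamma_n$-invariant if $A(g b)=gA(b)$ for all $g\in\Gamma_n$,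 $b\in B_n$. *)

(* Defs.v *)
From HB Require Import structures.
From mathcomp Require Import all_boot all_order all_algebra.
From mathcomp Require Import reals.

Set Implicit Arguments.
Unset Strict Implicit.
Unset Printing Implicit Defensive.

Import Order.TTheory GRing.Theory Num.Theory.
Local Open Scope ring_scope.

(* 'Z_n is the ring Z/nZ only for n >= 2; for n = 0, 1 it is Z/2Z. *)
Definition torus_vertex (n : nat) : finType := ('Z_n * 'Z_n)%type.

(* (v, false) is the edge (i,j) -> (i+1,j) and (v, true) is the edge
   (i,j) -> (i,j+1), where v = (i,j) is the tail. *)
Definition torus_edge (n : nat) : finType := (torus_vertex n * bool)%type.

Definition edge_tail n (e : torus_edge n) : torus_vertex n := e.1.

Definition edge_head n (e : torus_edge n) : torus_vertex n :=
  if e.2 then (e.1.1, e.1.2 + 1) else (e.1.1 + 1, e.1.2).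

Notation edge_space R n := {ffun torus_edge n -> R^o}.

Section TorusSpaces.
Variables (R : realType) (n : nat).
Implicit Types F G : edge_space R n.

Definition net_inflow F : {ffun torus_vertex n -> R^o} :=
  [ffun v => \sum_(e | edge_head e == v) F e - \sum_(e | edge_tail e == v) F e].

Fact net_inflow_linear : linear net_inflow.
Proof.
move=> a F G; apply/ffunP=> v; rewrite !ffunE scalerBr !scaler_sumr.
rewrite (eq_bigr (fun e => a *: F e + G e)); last by move=> e _; rewrite !ffunE.
rewrite [X in _ - X](eq_bigr (fun e => a *: F e + G e));
  last by move=> e _; rewrite !ffunE.
by rewrite !big_split /= opprD addrACA.
Qed.
HB.instance Definition _ :=
  GRing.isLinear.Build R (edge_space R n) {ffun torus_vertex n -> R^o} _
    net_inflow net_inflow_linear.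

Definition cycle_space : {vspace edge_space R n} := lker (linfun net_inflow).

Lemma cycle_spaceP F :
  reflect (forall v, \sum_(e | edge_head e == v) F e
                     = \sum_(e | edge_tail e == v) F e)
          (F \in cycle_space).
Proof.
rewrite memv_ker lfunE /=; apply: (iffP eqP) => [/ffunP F0 v | F0].
  by move: (F0 v); rewrite !ffunE => /eqP; rewrite subr_eq0 => /eqP.
by apply/ffunP=> v; rewrite !ffunE F0 subrr.
Qed.

Definition edge_dot F G : R := \sum_e F e * G e.

Fact edge_dot_bilinear :
  bilinear_for (GRing.Scale.Law.clone _ _ *%R _)
    (GRing.Scale.Law.clone _ _ (idfun \; *%R) _) edge_dot.
Proof.
split=> [G | F] a x y /=; rewrite /edge_dot mulr_sumr -big_split /=;
  apply: eq_bigr => e _; rewrite !ffunE.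
- by rewrite mulrDl mulrA.
- by rewrite mulrDr mulrCA.
Qed.
HB.instance Definition _ :=
  bilinear_isBilinear.Build R (edge_space R n) (edge_space R n) R _ _
    edge_dot edge_dot_bilinear.

Fact edge_dot_sym F G : edge_dot F G = (-1) ^+ false * idfun (edge_dot G F).
Proof. by rewrite mul1r; apply: eq_bigr => e _; rewrite mulrC. Qed.
HB.instance Definition _ :=
  isHermitianSesquilinear.Build R (edge_space R n) false idfun
    edge_dot edge_dot_sym.

Fact edge_dot_gt0 F : F != 0 -> 0 < edge_dot F F.
Proof.
move=> F0; rewrite lt_def sumr_ge0 ?andbT => [|e _]; last exact: sqr_ge0.
apply: contra F0 => /eqP/psumr_eq0P F0; apply/eqP/ffunP=> e; rewrite ffunE.
by apply/eqP; rewrite -[_ == _]orbb -mulf_eq0 F0 // => i _; apply: sqr_ge0.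
Qed.
HB.instance Definition _ :=
  isDotProduct.Build R (edge_space R n) edge_dot edge_dot_gt0.

Definition cut_space : {vspace edge_space R n} := orthov edge_dot cycle_space.

Definition l1norm F : R := \sum_e `|F e : R|.

(* The group Gamma_n. An endomorphism preserving the norm is injective, hence
   bijective by finite dimension, and the inclusion is then an equality. *)
Definition torus_isometry (g : 'End(edge_space R n)) : Prop :=
  (forall F, l1norm (g F) = l1norm F) /\ (g @: cycle_space <= cycle_space)%VS.

Definition invariant_projection_onto_cycles (P : 'End(edge_space R n)) : Prop :=
  [/\ (P \o P = P)%VF, limg P = cycle_space
    & forall g, torus_isometry g -> (P \o g = g \o P)%VF].

Notation cut_to_cycle := 'Hom(subvs_of cut_space, subvs_of cycle_space).

(* For g in Gamma_n, g b lies in the cut space, so [vsproj] is only the cast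
   of g b to the type [subvs_of cut_space]. *)
Definition invariant_map (A : cut_to_cycle) : Prop :=
  forall g, torus_isometry g ->
  forall b : subvs_of cut_space,
    vsval (A (vsproj cut_space (g (vsval b)))) = g (vsval (A b)).

Definition projection_of_map (A : cut_to_cycle) (P : 'End(edge_space R n)) :
    Prop :=
  forall (z : subvs_of cycle_space) (b : subvs_of cut_space),
    P (vsval z + vsval b) = vsval z + vsval (A b).

End TorusSpaces.

Notation cut_to_cycle R n :=
  'Hom(subvs_of (cut_space R n), subvs_of (cycle_space R n)).

(* Main.v *)
From HB Require Import structures.
From mathcomp Require Import all_boot all_order all_algebra.
From mathcomp Require Import ring zify reals.
Require Import Defs.

(* Let [grad] and [curl] be the maps from functions on vertices, respectively
   cells, to functions on edges. The cut space is the image of [grad], so a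
   translation-equivariant map [A] from cuts to cycles is determined by the flow
   [F = A (grad delta_0)]; for an invariant [A] this is a cycle fixed by the
   dihedral stabiliser of the vertex [0]. Such cycles are exactly the [curl h]
   with [h] odd under both reflections of the cells and antisymmetric under the
   exchange of the coordinates, so [h] is determined by arbitrary values
   [h (i, j)] with [0 <= i < j < floor (n/2)], and [A (grad f) = curl (h * f)].
   Conversely such an [A] must commute with all of Gamma_n. An l1-isometry is a
   signed permutation of the edges; for [n >= 5] the only cycles supported by at
   most four edges are multiples of the unit squares, so the isometry permutes
   the squares up to sign and respects their adjacency. After composition with
   translations, the exchange and one reflection it fixes three cells at a
   corner, hence all cells, and is then a scalar. *)

Set Implicit Arguments.
Unset Strict Implicit.
Unset Printing Implicit Defensive.

(** * Orthogonal complements for a dot product in finite dimension *)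

Section DotProductSplitting.
Import GRing.Theory Num.Theory.
Local Open Scope ring_scope.
Variables (R : realFieldType) (vT : vectType R) (form : {dot vT for idfun}).
Implicit Types (U : {vspace vT}) (u v : vT).

Lemma dot_self_eq0 u : form u u = 0 -> u = 0.
Proof. by move=> u0; apply: contra_eq u0 => /neq0_dnorm_gt0/lt0r_neq0. Qed.

Lemma capv_orthov U : (U :&: orthov form U)%VS = 0%VS.
Proof.
apply/eqP; rewrite -subv0; apply/subvP=> u; rewrite memv_cap memv0.
by case/andP=> uU /mem_orthovP/(_ _ uU)/dot_self_eq0->.
Qed.

(** Rank-nullity for [coords], the pairings with a basis of [U]: its kernel lies in the complement
    and its image has dimension at most [\dim U]. *)
Lemma dim_orthov_ge U : (\dim {:vT} <= \dim (orthov form U) + \dim U)%N.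
Proof.
pose coords u : 'rV[R]_(\dim U) := \row_i form u (vbasis U)`_i.
have coords_lin : linear coords.
  by move=> a u v; apply/rowP=> i; rewrite !mxE linearPl.
pose lc := GRing.isLinear.Build _ _ _ _ coords coords_lin.
pose coordsL : {linear vT -> 'rV[R]_(\dim U)} := HB.pack coords lc.
rewrite -(limg_ker_dim (linfun coordsL) {:vT}) capfv leq_add //.
  apply/dimvS/subvP=> u; rewrite memv_ker lfunE /= => /eqP/rowP u0.
  apply/mem_orthovP=> v vU; rewrite (coord_vbasis vU) linear_sumr big1 // => i _.
  by have:= u0 i; rewrite linearZr_LR /= !mxE => ->; rewrite mulr0.
by rewrite (leq_trans (dimvS (subvf _))) // dimvf /dim /= mul1n.
Qed.

Lemma addv_orthov U : (U + orthov form U)%VS = fullv.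
Proof.
apply/eqP; rewrite eqEdim subvf /= dimv_disjoint_sum ?capv_orthov //.
by rewrite addnC dim_orthov_ge.
Qed.

Lemma orthovK U : orthov form (orthov form U) = U.
Proof.
apply/eqP; rewrite eq_sym eqEsubv orthov_sym subvv /=; apply/subvP=> u uUU.
have /memv_addP[v vU [w wU' def_u]] : u \in (U + orthov form U)%VS.
  by rewrite addv_orthov memvf.
have w0 : form w w = 0.
  have /mem_orthovP/(_ _ wU') := uUU.
  rewrite def_u linearDl /=; move/mem_orthovP: (wU') => /(_ _ vU).
  by rewrite hermC /= mul1r => ->; rewrite add0r.
by rewrite def_u (dot_self_eq0 w0) addr0.
Qed.
End DotProductSplitting.

(** * Induction around the cyclic group *)

Section Residues.
Import GRing.Theory.
Local Open Scope ring_scope.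
Variable n : nat.

Lemma Zn_natr_neq0 k : (1 < n)%N -> (0 < k < n)%N -> (k%:R : 'Z_n) != 0.
Proof.
move=> n1 /andP[k0 kn]; rewrite -val_eqE /= val_Zp_nat // modn_small //.
by rewrite -lt0n.
Qed.

Lemma Zn_ind (P : 'Z_n -> Prop) :
  P 0 -> (forall i, P i -> P (i + 1)) -> forall i, P i.
Proof.
move=> P0 PS i; rewrite -[i]natr_Zp; elim: (i : nat) => // k IHk.
by rewrite -natr1; apply: PS.
Qed.

Lemma Zn_step_const (T : Type) (f : 'Z_n -> T) :
  (forall i, f (i - 1) = f i) -> forall i, f i = f 0.
Proof.
by move=> fS; elim/Zn_ind => // i IHi; rewrite -IHi -(fS (i + 1)) addrK.
Qed.
End Residues.

(** * Gradient, curl and convolution on the torus *)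

Section TorusCalculus.
Import Order.TTheory GRing.Theory Num.Theory.
Local Open Scope ring_scope.
Variables (R : realType) (n : nat).
Local Notation vertex := (torus_vertex n).
Local Notation vfun := {ffun torus_vertex n -> R^o}.
Local Notation efun := (edge_space R n).
Implicit Types (F : efun) (f h : vfun) (v p : vertex).

Definition grad f : efun := [ffun e => f (edge_head e) - f (edge_tail e)].

(* The cell [(i, j)] is the square with corners (i, j) and (i + 1, j + 1). *)
Definition curl h : efun :=
  [ffun e => if e.2 then h (e.1.1 - 1, e.1.2) - h e.1
             else h e.1 - h (e.1.1, e.1.2 - 1)].

(** Vertices and cells share one index group: [f] lives on vertices, [h] and the result on cells. *)
Definition conv h f : vfun :=
  [ffun p : vertex => \sum_(v : vertex) h (p - v : vertex) * f v].

Definition delta v : vfun := [ffun u => (u == v)%:R].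

Fact grad_linear : linear grad.
Proof. by move=> a f g; apply/ffunP=> e; rewrite !ffunE scalerBr opprD addrACA. Qed.
HB.instance Definition _ := GRing.isLinear.Build R vfun efun _ grad grad_linear.

Fact curl_linear : linear curl.
Proof.
move=> a f g; apply/ffunP=> e; rewrite !ffunE.
by case: ifP => _; rewrite scalerBr opprD addrACA.
Qed.
HB.instance Definition _ := GRing.isLinear.Build R vfun efun _ curl curl_linear.

Fact conv_linear h : linear (conv h).
Proof.
move=> a f g; apply/ffunP=> p; rewrite !ffunE scaler_sumr -big_split.
by apply: eq_bigr => v _; rewrite !ffunE mulrDr scalerAr.
Qed.
HB.instance Definition _ h :=
  GRing.isLinear.Build R vfun vfun _ (conv h) (conv_linear h).

Lemma convPl a h h' f : conv (a *: h + h') f = a *: conv h f + conv h' f.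
Proof.
apply/ffunP=> p; rewrite !ffunE scaler_sumr -big_split.
by apply: eq_bigr => v _; rewrite !ffunE mulrDl scalerAl.
Qed.

Lemma sum_delta f : f = \sum_v f v *: delta v.
Proof.
apply/ffunP=> u; rewrite sum_ffunE (bigD1 u) //= big1 ?addr0 => [|v vu].
  by rewrite !ffunE eqxx [_ *: _]mulr1.
by rewrite !ffunE eq_sym (negPf vu) scaler0.
Qed.

Lemma conv_delta h v : conv h (delta v) = [ffun p : vertex => h (p - v : vertex)].
Proof.
apply/ffunP=> p; rewrite !ffunE (bigD1 v) //= big1 ?addr0 => [|u uv].
  by rewrite ffunE eqxx mulr1.
by rewrite ffunE (negPf uv) mulr0.
Qed.

Lemma net_inflowE F v :
  net_inflow F v = F ((v.1 - 1, v.2), false) + F ((v.1, v.2 - 1), true)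
                   - (F (v, false) + F (v, true)).
Proof.
have sum_edge (P : pred (torus_edge n)) :
    \sum_(e | P e) F e = \sum_(u | P (u, false)) F (u, false)
                         + \sum_(u | P (u, true)) F (u, true).
  rewrite [in RHS]big_mkcond [X in _ + X]big_mkcond -big_split /= big_mkcond.
  pose G u b := if P (u, b) then F (u, b) else 0.
  transitivity (\sum_u \sum_b G u b); last first.
    by apply: eq_bigr => u _; rewrite big_bool addrC.
  by rewrite pair_bigA; apply: eq_bigr => -[].
rewrite ffunE !sum_edge; case: v => i j /=; congr (_ + _ - (_ + _)).
- apply: big_pred1 => -[k l]; rewrite /edge_head /= !xpair_eqE.
  by rewrite -(inj_eq (addIr 1) k) subrK.
- apply: big_pred1 => -[k l]; rewrite /edge_head /= !xpair_eqE.
  by rewrite -(inj_eq (addIr 1) l) subrK.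
- exact: big_pred1_eq.
- exact: big_pred1_eq.
Qed.

Lemma mem_cycle_space F :
  reflect (forall i j, F ((i - 1, j), false) + F ((i, j - 1), true)
                       = F ((i, j), false) + F ((i, j), true))
          (F \in cycle_space R n).
Proof.
rewrite memv_ker lfunE /=; apply: (iffP eqP) => [/ffunP F0 i j | F0].
  by move: (F0 (i, j)); rewrite net_inflowE !ffunE => /eqP; rewrite subr_eq0 => /eqP.
by apply/ffunP=> -[i j]; rewrite net_inflowE /= F0 subrr ffunE.
Qed.

Lemma curl_cycle h : curl h \in cycle_space R n.
Proof. apply/mem_cycle_space=> i j; rewrite !ffunE /=; ring. Qed.

(** Summation by parts: the net inflow is the adjoint of [grad]. *)
Lemma edge_dot_gradE f F : edge_dot (grad f) F = \sum_v f v * net_inflow F v.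
Proof.
rewrite [in RHS](eq_bigr (fun v =>
    \sum_(e | edge_head e == v) f (edge_head e) * F e -
    \sum_(e | edge_tail e == v) f (edge_tail e) * F e)) => [|v _].
  have regroup (k : torus_edge n -> vertex) (G : torus_edge n -> R) :
      \sum_v \sum_(e | k e == v) G e = \sum_e G e.
    by rewrite [RHS](partition_big k xpredT).
  rewrite sumrB (regroup _ (fun e => f (edge_head e) * F e)).
  rewrite (regroup _ (fun e => f (edge_tail e) * F e)) -sumrB.
  by apply: eq_bigr => e _; rewrite ffunE mulrBl.
rewrite ffunE mulrBr !mulr_sumr; congr (_ - _).
  by apply: eq_bigr => e /eqP->.
by apply: eq_bigr => e /eqP->.
Qed.

Lemma cycle_space_orthov :
  cycle_space R n = orthov (@edge_dot R n) (limg (linfun grad)).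
Proof.
apply/vspaceP=> F; apply/idP/mem_orthovP => [|F0].
  rewrite memv_ker lfunE /= => /eqP F0 _ /memv_imgP[f _ ->].
  rewrite lfunE hermC /= mul1r edge_dot_gradE F0 big1 // => v _.
  by rewrite ffunE mulr0.
rewrite memv_ker lfunE /=; apply/eqP/ffunP=> v; rewrite [RHS]ffunE.
(* Pairing with the gradient of [delta v] reads off the net inflow at [v]. *)
have := F0 (grad (delta v)); rewrite -[grad _]lfunE memv_img ?memvf //.
rewrite lfunE /= hermC /= mul1r edge_dot_gradE => /(_ isT)/eqP.
rewrite (bigD1 v) //= big1 => [|u uv].
  by rewrite ffunE eqxx mul1r addr0 => /eqP.
by rewrite ffunE (negPf uv) mul0r.
Qed.

Lemma cut_spaceE : cut_space R n = limg (linfun grad).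
Proof. by rewrite /cut_space cycle_space_orthov orthovK. Qed.

Lemma cut_spaceP F : reflect (exists f, F = grad f) (F \in cut_space R n).
Proof.
rewrite cut_spaceE; apply: (iffP memv_imgP) => [[f _ ->]|[f ->]]; exists f.
  by rewrite lfunE.
by rewrite ?memvf.
by rewrite lfunE.
Qed.

Lemma cycle_cut_dec F : exists (z : subvs_of (cycle_space R n))
  (b : subvs_of (cut_space R n)), F = vsval z + vsval b.
Proof.
have /memv_addP[z zZ [b bB ->]] : F \in (cycle_space R n + cut_space R n)%VS.
  by rewrite addv_orthov memvf.
by exists (Subvs zZ), (Subvs bB).
Qed.

Lemma cycle_cut_cap : (cycle_space R n :&: cut_space R n)%VS = 0%VS.
Proof. exact: capv_orthov. Qed.

Lemma grad_eq0 f : grad f = 0 -> forall v, f v = f (0, 0).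
Proof.
move=> f0 [i j].
have fi k l : f (k - 1, l) = f (k, l).
  move/ffunP: f0 => /(_ ((k - 1, l), false)); rewrite !ffunE /edge_head /edge_tail /= subrK.
  by move/eqP; rewrite subr_eq0 => /eqP->.
have fj k l : f (k, l - 1) = f (k, l).
  move/ffunP: f0 => /(_ ((k, l - 1), true)); rewrite !ffunE /edge_head /edge_tail /= subrK.
  by move/eqP; rewrite subr_eq0 => /eqP->.
rewrite (@Zn_step_const n _ (fun k => f (k, j)) (fun k => fi k j)).
exact: (@Zn_step_const n _ (fun l => f (0, l)) (fj 0)).
Qed.

End TorusCalculus.

(** * Symmetries of the torus *)

Section Symmetries.
Import Order.TTheory GRing.Theory Num.Theory.
Local Open Scope ring_scope.
Variables (R : realType) (n : nat).
Local Notation vertex := (torus_vertex n).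
Local Notation vfun := {ffun torus_vertex n -> R^o}.
Local Notation efun := (edge_space R n).
Implicit Types (F : efun) (f h : vfun) (v p : vertex).

(* [TReflect] sends the vertex [(i, j)] to [(1 - i, j)], which fixes the
   cell [(0, 0)] and not the vertex [(0, 0)]. *)
Inductive torus_gen := TShift of vertex | TSwap | TReflect.
Implicit Types x : torus_gen.

Definition gen_vertex x v : vertex :=
  match x with
  | TShift a => v - a
  | TSwap => (v.2, v.1)
  | TReflect => (1 - v.1, v.2)
  end.

(** The reflection carries the corner columns [i], [i + 1] of a cell to [1 - i], [- i], so the new
    cell has index [- i]. *)
Definition gen_cell x p : vertex :=
  match x with
  | TShift a => p - a
  | TSwap => (p.2, p.1)
  | TReflect => (- p.1, p.2)
  end.

Definition gen_edge x (e : torus_edge n) : torus_edge n :=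
  match x with
  | TShift a => (e.1 - a : vertex, e.2)
  | TSwap => ((e.1.2, e.1.1), ~~ e.2)
  | TReflect => ((if e.2 then 1 - e.1.1 else - e.1.1, e.1.2), e.2)
  end.

(** The reflection turns the horizontal edges around. *)
Definition gen_neg x (e : torus_edge n) : bool :=
  if x is TReflect then ~~ e.2 else false.

(** The exchange and the reflection reverse the orientation of the cells. *)
Definition gen_cell_neg x : bool := if x is TShift _ then false else true.

Definition gen_act x F : efun :=
  [ffun e => (-1) ^+ gen_neg x e * F (gen_edge x e)].

Definition gen_vact x f : vfun := [ffun v => f (gen_vertex x v)].

Definition gen_cact x h : vfun :=
  [ffun p => (-1) ^+ gen_cell_neg x * h (gen_cell x p)].

Fact gen_act_linear x : linear (gen_act x).
Proof.
move=> a F G; apply/ffunP=> e; rewrite !ffunE mulrDr; congr (_ + _).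
exact: mulrCA.
Qed.
HB.instance Definition _ x :=
  GRing.isLinear.Build R efun efun _ (gen_act x) (gen_act_linear x).

Lemma gen_act_grad x f : gen_act x (grad f) = grad (gen_vact x f).
Proof.
apply/ffunP=> -[[i j] s]; rewrite !ffunE /edge_head /edge_tail.
case: x => [[a b]||]; case: s => /=; rewrite ?expr0 ?mul1r //=.
- by congr (f (_, _) - _); rewrite addrAC.
- by congr (f (_, _) - _); rewrite addrAC.
- rewrite expr1 mulN1r opprB; congr (f (_, _) - f (_, _)); ring.
Qed.

Lemma gen_act_curl x h : gen_act x (curl h) = curl (gen_cact x h).
Proof.
apply/ffunP=> -[[i j] s]; rewrite !ffunE.
case: x => [[a b]||]; case: s => /=; rewrite ?expr0 ?expr1 ?mul1r ?mulN1r //=.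
- by congr (h (_, _) - _); rewrite addrAC.
- by congr (_ - h (_, _)); rewrite addrAC.
- by rewrite opprK addrC.
- by rewrite opprK addrC.
- by rewrite opprK [RHS]addrC; congr (h (_, _) - h (_, _)); ring.
- by rewrite opprB opprK addrC.
Qed.

Lemma gen_edge_inj x : injective (gen_edge x).
Proof.
move=> [[i j] s] [[i' j'] s'] /[dup] /(congr1 snd) + /(congr1 fst).
case: x => [a||] /= E.
- by rewrite E => /addIr->.
- by move=> [-> ->]; rewrite (negb_inj E).
- rewrite E => /[dup] /(congr1 snd) /= -> /(congr1 fst) /=.
  by case: s' {E} => [/addrI|] /oppr_inj->.
Qed.

Lemma gen_cycle x F : F \in cycle_space R n -> gen_act x F \in cycle_space R n.
Proof.
move/mem_cycle_space => F0; apply/mem_cycle_space => i j; rewrite !ffunE.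
case: x => [[a b]||] /=; rewrite ?expr0 ?expr1 ?mul1r ?mulN1r /=.
- have := F0 (i - a) (j - b).
  by rewrite (addrAC i) (addrAC j).
- have := F0 j i; rewrite addrC => ->; exact: addrC.
- have := F0 (1 - i) j; have -> : 1 - i - 1 = - i :> 'Z_n by ring.
  have -> : - (i - 1) = 1 - i :> 'Z_n by ring.
  move/eqP; rewrite -subr_eq0 => /eqP E; apply/eqP; rewrite -subr_eq0 -{}E.
  by apply/eqP; ring.
Qed.

Lemma gen_isometry x : torus_isometry (linfun (gen_act x)).
Proof.
split=> [F|]; last first.
  by apply/subvP=> _ /memv_imgP[F FZ ->]; rewrite lfunE gen_cycle.
rewrite lfunE /l1norm [RHS](reindex_inj (@gen_edge_inj x)).
by apply: eq_bigr => e _; rewrite ffunE normrM normrX normrN1 expr1n mul1r.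
Qed.

End Symmetries.
Arguments TShift {n}.
Arguments TSwap {n}.
Arguments TReflect {n}.

(** * Isometries as signed permutations *)

Section Monomial.
Import Order.TTheory GRing.Theory Num.Theory.
Local Open Scope ring_scope.
Variables (R : realType) (n : nat).
Local Notation efun := (edge_space R n).
Implicit Types (F : efun) (e : torus_edge n).

Definition edelta e : efun := [ffun f => (f == e)%:R].

Lemma sum_edelta F : F = \sum_e F e *: edelta e.
Proof.
apply/ffunP=> f; rewrite sum_ffunE (bigD1 f) //= big1 ?addr0 => [|e ef].
  by rewrite !ffunE eqxx [_ *: _]mulr1.
by rewrite !ffunE eq_sym (negPf ef) scaler0.
Qed.

Lemma l1norm_edelta e : l1norm (edelta e) = 1.
Proof.
rewrite /l1norm (bigD1 e) //= big1 ?addr0 => [|f fe]; rewrite ffunE.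
  by rewrite eqxx normr1.
by rewrite (negPf fe) normr0.
Qed.

Lemma l1norm_edelta2 e e' c : e != e' -> `|c| = 1 ->
  l1norm (edelta e + c *: edelta e') = 2.
Proof.
move=> ee' c1; rewrite /l1norm (bigD1 e) // (bigD1 e') 1?eq_sym //= big1.
  rewrite !ffunE !eqxx (negPf ee') eq_sym (negPf ee') scaler0 [_ *: _]mulr1.
  by rewrite add0r !addr0 normr1 c1.
move=> f /andP[fe fe']; rewrite !ffunE (negPf fe) (negPf fe').
by rewrite scaler0 addr0 normr0.
Qed.

(* [g d_e] and [g d_e'] have disjoint supports: the norms of [d_e + d_e'] and
   [d_e - d_e'] force [|a + b| = |a| + |b| = |a - b|] at every edge. *)
Lemma l1isometry_disjoint (g : 'End(efun)) e e' f :
  (forall F, l1norm (g F) = l1norm F) -> e != e' ->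
  g (edelta e) f * g (edelta e') f = 0.
Proof.
move=> gN ee'.
have norm_eq c : `|c| = 1 ->
    `|g (edelta e) f + c * g (edelta e') f|
    = `|g (edelta e) f| + `|g (edelta e') f|.
  move=> c1; apply/esym/eqP; rewrite -subr_eq0; apply/eqP.
  pose t k := `|g (edelta e) k| + `|g (edelta e') k|
              - `|g (edelta e) k + c * g (edelta e') k|.
  have t_ge0 k : true -> 0 <= t k.
    by rewrite subr_ge0 (le_trans (ler_normD _ _)) // normrM c1 mul1r.
  have : \sum_k t k = 0.
    transitivity (l1norm (g (edelta e)) + l1norm (g (edelta e'))
                  - l1norm (g (edelta e + c *: edelta e'))).
      rewrite linearD linearZ /l1norm -big_split -sumrB.
      by apply: eq_bigr => k _; rewrite /t !ffunE.
    by rewrite !gN !l1norm_edelta l1norm_edelta2 // subrr.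
  by move=> /(psumr_eq0P t_ge0)/(_ f isT).
have := congr1 (fun z => z ^+ 2)
  (etrans (norm_eq 1 (normr1 _)) (esym (norm_eq (-1) (normrN1 _)))).
rewrite !real_normK ?num_real // => /eqP; rewrite -subr_eq0 => /eqP E.
have : g (edelta e) f * g (edelta e') f *+ 4 = 0 by rewrite -[RHS]E; ring.
by move/eqP; rewrite mulrn_eq0 /= => /eqP.
Qed.

(** Choosing one edge in the support of each [g (edelta e)] gives an injective, hence bijective,
    [pi]. Disjointness then leaves no other edge in these supports, and the norm makes each
    coefficient a sign. *)
Lemma l1isometry_monomial (g : 'End(efun)) :
  (forall F, l1norm (g F) = l1norm F) ->
  exists pi : torus_edge n -> torus_edge n, exists s : torus_edge n -> R,
    [/\ injective pi, forall e, s e ^+ 2 = 1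
      & forall F e, g F (pi e) = s e * F e].
Proof.
move=> gN.
have /fin_all_exists[pi piP] e : exists f, g (edelta e) f != 0.
  apply/existsP; apply: contraT; rewrite negb_exists => /forallP g0.
  have := l1norm_edelta e; rewrite -gN /l1norm big1 => [/eqP|f _].
    by rewrite eq_sym oner_eq0.
  by have := g0 f; rewrite negbK => /eqP->; rewrite normr0.
have pi_inj : injective pi.
  move=> e e' E; apply: contraTeq isT => /(l1isometry_disjoint (pi e) gN)/eqP.
  by rewrite mulf_eq0 (negPf (piP e)) E (negPf (piP e')).
have off e f : f != pi e -> g (edelta e) f = 0.
  have [pi' _ piK] := injF_bij pi_inj; rewrite -[f]piK => fe.
  have ee' : e != pi' f by apply: contraNneq fe => ->; rewrite piK.
  have /eqP := l1isometry_disjoint (pi (pi' f)) gN ee'.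
  by rewrite mulf_eq0 (negPf (piP _)) orbF => /eqP.
exists pi, (fun e => g (edelta e) (pi e)); split=> // [e|F e].
  have := l1norm_edelta e; rewrite -gN /l1norm (bigD1 (pi e)) //= big1 ?addr0.
    by move=> E; rewrite -[_ ^+ 2]real_normK ?num_real // E expr1n.
  by move=> f fe; rewrite off ?normr0.
rewrite [in LHS](sum_edelta F) linear_sum sum_ffunE (bigD1 e) //= big1 ?addr0.
  by rewrite linearZ ffunE mulrC.
move=> e' ee'; rewrite linearZ ffunE off ?scaler0 //.
by apply: contra ee' => /eqP/pi_inj->.
Qed.

Lemma l1isometry_dot (g : 'End(efun)) F G :
  (forall F, l1norm (g F) = l1norm F) -> edge_dot (g F) (g G) = edge_dot F G.
Proof.
case/l1isometry_monomial=> pi [s [pi_inj s2 gE]].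
rewrite /edge_dot (reindex_inj pi_inj); apply: eq_bigr => e _.
by rewrite !gE mulrACA -expr2 s2 mul1r.
Qed.

Lemma l1isometry_lker (g : 'End(efun)) :
  (forall F, l1norm (g F) = l1norm F) -> lker g == 0%VS.
Proof.
move=> gN; rewrite -subv0; apply/subvP=> F; rewrite memv_ker memv0 => /eqP gF0.
apply/eqP/(dot_self_eq0 (form := @edge_dot R n)).
by rewrite -[LHS](l1isometry_dot F F gN) gF0 linear0l.
Qed.

(** Being injective, [g] maps the cycle space onto itself; as a signed permutation it preserves
    orthogonality to it. *)
Lemma isometry_cut (g : 'End(efun)) F :
  torus_isometry g -> F \in cut_space R n -> g F \in cut_space R n.
Proof.
case=> gN gZ /mem_orthovP FB; apply/mem_orthovP => z.
have -> : cycle_space R n = (g @: cycle_space R n)%VS.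
  apply/esym/eqP; rewrite eqEdim gZ limg_dim_eq ?leqnn //.
  by rewrite (eqP (l1isometry_lker gN)) capv0.
by case/memv_imgP=> w wZ ->; rewrite /= l1isometry_dot // FB.
Qed.

Lemma isometry_cycle (g : 'End(efun)) F :
  torus_isometry g -> F \in cycle_space R n -> g F \in cycle_space R n.
Proof. by case=> _ /subvP gZ FZ; rewrite gZ // memv_img. Qed.

Lemma isometry_inj (g : 'End(efun)) : torus_isometry g -> injective g.
Proof. by case=> /l1isometry_lker/lker0P. Qed.

Lemma isometry_comp (g g' : 'End(efun)) :
  torus_isometry g -> torus_isometry g' -> torus_isometry (g \o g')%VF.
Proof.
move=> [gN gZ] [g'N g'Z]; split=> [F|]; first by rewrite comp_lfunE gN g'N.
by rewrite limg_comp (subv_trans _ gZ) // limgS.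
Qed.
End Monomial.

(** * Cycles with at most four edges *)

Section ShortCycles.
Import Order.TTheory GRing.Theory Num.Theory.
Local Open Scope ring_scope.
Variables (R : realType) (n : nat).
Hypothesis n_ge5 : (5 <= n)%N.
Local Notation vertex := (torus_vertex n).
Local Notation efun := (edge_space R n).
Implicit Types (F : efun) (e : torus_edge n) (p : vertex).

Definition square p : efun := curl (delta R p).

Definition supp F : {set torus_edge n} := [set e | F e != 0].

Lemma squareE p x y s : square p ((x, y), s) =
  if s then (((x == p.1 + 1) && (y == p.2))%:R : R) - ((x == p.1) && (y == p.2))%:R
  else ((x == p.1) && (y == p.2))%:R - ((x == p.1) && (y == p.2 + 1))%:R.
Proof.
by case: p s => i j [] /=; rewrite !ffunE /= !xpair_eqE subr_eq.
Qed.

Let n_gt1 : (1 < n)%N. Proof. exact: leq_trans n_ge5. Qed.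

Lemma Zn_add1_neq (i : 'Z_n) : (i + 1 == i) = false.
Proof. by rewrite -subr_eq0 addrC addKr oner_eq0. Qed.

Lemma Zn_sub1_neq (i : 'Z_n) : (i - 1 == i) = false.
Proof. by rewrite -(inj_eq (addIr 1)) subrK eq_sym Zn_add1_neq. Qed.

(** Summing the conservation law over column [i] cancels the [V] terms after a shift of the index.
    Splitting the flow into [H] and [V] lets the lemma apply with the coordinates exchanged. *)
Lemma flow_flux (H V : 'Z_n -> 'Z_n -> R) :
  (forall i j, H (i - 1) j + V i (j - 1) = H i j + V i j) ->
  forall i, \sum_j H i j = \sum_j H 0 j.
Proof.
move=> fl; apply: (@Zn_step_const n _ (fun i => \sum_j H i j)) => i.
have : \sum_j (H (i - 1) j + V i (j - 1)) = \sum_j (H i j + V i j).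
  exact: eq_bigr.
rewrite !big_split /= [X in _ = _ + X](reindex_inj (addIr (-1))) /=.
exact: addIr.
Qed.

Lemma wide_support F (key : torus_edge n -> 'Z_n) :
  (forall i, exists2 e, F e != 0 & key e = i) -> (n <= #|supp F|)%N.
Proof.
move=> keyP; apply: (@leq_trans #|key @: supp F|).
  rewrite -[leqLHS](Zp_cast n_gt1) -[leqLHS]card_ord -cardsT subset_leq_card //.
  apply/subsetP=> i _; have [e Fe <-] := keyP i.
  by rewrite imset_f ?inE.
exact: leq_imset_card.
Qed.

(* Four edges are fewer than the [n] rows, so the flux of [F] through some row,
   hence through every row, is zero; each row or column met by the support is
   then met at least twice. *)
Lemma four_edge_support F :
  F \in cycle_space R n -> F != 0 -> (#|supp F| <= 4)%N ->
  exists i b, forall x y s, F ((x, y), s) != 0 ->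
    if s then ((x == i) || (x == i + 1)) && (y == b)
    else (x == i) && ((y == b) || (y == b + 1)).
Proof.
move=> /mem_cycle_space fl F0 S4.
have few (key : torus_edge n -> 'Z_n) :
    ~ (forall i, exists2 e, F e != 0 & key e = i).
  by move/wide_support=> /leq_trans/(_ S4); rewrite leqNgt n_ge5.
have sum_neq0 (G : 'Z_n -> R) : \sum_i G i != 0 -> exists i, G i != 0.
  move=> G0; apply/existsP; apply: contraNT G0; rewrite negb_exists.
  by move=> /forallP G0; rewrite big1 // => i _; have := G0 i; rewrite negbK => /eqP.
have sumH i : \sum_j F ((i, j), false) = 0.
  apply/eqP/negPn/negP=> H0; apply: (few (fun e => e.1.1)) => k.
  have /sum_neq0[j Hj] : \sum_j F ((k, j), false) != 0.
    move: H0; rewrite (@flow_flux _ (fun i j => F ((i, j), true)) fl).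
    by rewrite -(@flow_flux _ (fun i j => F ((i, j), true)) fl k).
  by exists ((k, j), false).
have sumV j : \sum_i F ((i, j), true) = 0.
  have fl' k l : F ((l, k - 1), true) + F ((l - 1, k), false)
                 = F ((l, k), true) + F ((l, k), false).
    by rewrite addrC fl addrC.
  apply/eqP/negPn/negP=> V0; apply: (few (fun e => e.1.2)) => k.
  have /sum_neq0[i Vi] : \sum_i F ((i, k), true) != 0.
    have flux := @flow_flux (fun j i => F ((i, j), true))
      (fun j i => F ((i, j), false)) fl'.
    by move: V0; rewrite flux -(flux k).
  by exists ((i, k), true).
have pair_neq0 (G : 'Z_n -> R) i : \sum_i G i = 0 -> G i != 0 ->
    exists2 k, k != i & G k != 0.
  move=> G0 Gi; apply/exists_inP; apply: contraNT Gi; rewrite negb_exists_in.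
  move=> /forall_inP Gk; rewrite -G0 (bigD1 i) //= big1 ?addr0 // => k ki.
  by have := Gk k ki; rewrite negbK => /eqP.
have [[[x y] s] Fe] : exists e, F e != 0.
  apply/existsP; apply: contraNT F0; rewrite negb_exists => /forallP F0.
  by apply/eqP/ffunP=> e; have := F0 e; rewrite negbK ffunE => /eqP.
(* Without horizontal edges the flow is constant along a vertical line, so the support would meet
   every row. *)
have [[i j] Hij] : exists v : vertex, F (v, false) != 0.
  case: s Fe => Fe; last by exists (x, y).
  apply/existsP; apply: contraT; rewrite negb_exists => /forallP H0.
  case: (few (fun e => e.1.2)) => l; exists ((x, l), true) => //.
  rewrite (@Zn_step_const n _ (fun l => F ((x, l), true))); last first.
    move=> k; have := fl x k.
    have /eqP-> := negPn (H0 (x - 1, k)); have /eqP-> := negPn (H0 (x, k)).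
    by rewrite !add0r.
  rewrite -(@Zn_step_const n _ (fun l => F ((x, l), true)) _ y) // => k.
  have := fl x k.
  have /eqP-> := negPn (H0 (x - 1, k)); have /eqP-> := negPn (H0 (x, k)).
  by rewrite !add0r.
have [[k b] Vkb] : exists v : vertex, F (v, true) != 0.
  case: s Fe => Fe; first by exists (x, y).
  apply/existsP; apply: contraT; rewrite negb_exists => /forallP V0.
  have stp k : F ((k - 1, y), false) = F ((k, y), false).
    have := fl k y.
    have /eqP-> := negPn (V0 (k, y - 1)); have /eqP-> := negPn (V0 (k, y)).
    by rewrite !addr0.
  case: (few (fun e => e.1.1)) => l; exists ((l, y), false) => //.
  rewrite (@Zn_step_const n _ (fun l => F ((l, y), false)) stp).
  by rewrite -(@Zn_step_const n _ (fun l => F ((l, y), false)) stp x).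
have [j' j'j Hij'] := pair_neq0 (fun j => F ((i, j), false)) j (sumH i) Hij.
have [k' k'k Vkb'] := pair_neq0 (fun k => F ((k, b), true)) k (sumV b) Vkb.
(* These four distinct edges exhaust the support. *)
pose T := [:: ((i, j), false); ((i, j'), false); ((k, b), true); ((k', b), true)].
have suppE e : F e != 0 -> e \in T.
  have TS : [set e in T] \subset supp F.
    apply/subsetP=> f; rewrite !inE.
    by case/or4P=> /eqP->.
  have /eqP ST : [set e in T] == supp F.
    rewrite eqEcard TS (leq_trans S4) // cardsE.
    have /card_uniqP-> // : uniq T.
    rewrite /= !inE !xpair_eqE /= !andbF !andbT !eqxx !orbF /=.
    by rewrite (eq_sym j) (negPf j'j) (eq_sym k) (negPf k'k).
  move=> Fe'; have : e \in supp F by rewrite inE.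
  by rewrite -ST inE.
have H0 u v : u != i -> F ((u, v), false) = 0.
  move=> ui; apply/eqP; apply: contraNT ui => /suppE.
  by rewrite !inE !xpair_eqE /= !andbF !andbT !orbF; case/orP=> /andP[].
have V0 u v : (F ((u, v), true) == 0) || (((u == k) || (u == k')) && (v == b)).
  case: eqP => //= /eqP/suppE.
  by rewrite !inE !xpair_eqE /= !andbF !andbT /= andb_orl.
(* All horizontal edges start in column [i], so the flow through one of them must continue along
   vertical edges at both ends. Those lie at height [b], in the columns [k] and [k']. *)
have corner v : F ((i, v), false) != 0 ->
  [/\ (v == b) || (v == b + 1), (i == k) || (i == k') & (i + 1 == k) || (i + 1 == k')].
  move=> Hv.
  have Vi : (F ((i, v - 1), true) != 0) || (F ((i, v), true) != 0).
    apply: contraTT (Hv); rewrite negb_or !negbK => /andP[/eqP V1 /eqP V2].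
    by have := fl i v; rewrite V1 V2 H0 ?Zn_sub1_neq // !addr0 => <-.
  have Vi1 : (F ((i + 1, v - 1), true) != 0) || (F ((i + 1, v), true) != 0).
    apply: contraTT (Hv); rewrite negb_or !negbK => /andP[/eqP V1 /eqP V2].
    by have := fl (i + 1) v; rewrite V1 V2 addrK (H0 (i + 1)) ?Zn_add1_neq // !addr0 => ->.
  move: Vi Vi1; have := V0 i (v - 1); have := V0 i v.
  have := V0 (i + 1) (v - 1); have := V0 (i + 1) v; rewrite subr_eq.
  do 4!case: (_ == 0) => //=; case: (v == b) => //=; case: (v == b + 1) => //=;
  by case: (i == k); case: (i == k'); case: (i + 1 == k); case: (i + 1 == k').
have [jb ik i1k] := corner j Hij; have [j'b _ _] := corner j' Hij'.
have kk : ((k == i) && (k' == i + 1)) || ((k' == i) && (k == i + 1)).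
  case/orP: ik i1k => /eqP<-; rewrite Zn_add1_neq /= eqxx /= ?orbF => /eqP->.
    by rewrite eqxx.
  by rewrite eqxx orbT.
have jj : ((j == b) && (j' == b + 1)) || ((j' == b) && (j == b + 1)).
  case/orP: jb j'b j'j => /eqP->; rewrite ?Zn_add1_neq => /orP[]/eqP->;
    by rewrite ?eqxx ?orbT.
exists i, b => u v [] /suppE; rewrite !inE !xpair_eqE /= !andbF !andbT ?orbF /=.
  rewrite -andb_orl => /andP[uk ->]; rewrite andbT.
  by case/orP: kk uk => /andP[/eqP-> /eqP->] //; rewrite orbC.
rewrite -andb_orr => /andP[-> vj] /=.
by case/orP: jj vj => /andP[/eqP-> /eqP->] //; rewrite orbC.
Qed.

(** Conservation at three corners determines the other three values from the one on the bottom
    edge. *)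
Lemma four_edge_cycle F :
  F \in cycle_space R n -> F != 0 -> (#|supp F| <= 4)%N ->
  exists p a, F = a *: square p.
Proof.
move=> FZ F0 /(four_edge_support FZ F0)[i [b supp]].
move/mem_cycle_space: FZ => fl.
have H0 x y : ~~ ((x == i) && ((y == b) || (y == b + 1))) -> F ((x, y), false) = 0.
  by move=> xy; apply/eqP; apply: contraNT xy => /supp.
have V0 x y : ~~ (((x == i) || (x == i + 1)) && (y == b)) -> F ((x, y), true) = 0.
  by move=> xy; apply/eqP; apply: contraNT xy => /supp.
exists (i, b), (F ((i, b), false)).
have Vib : F ((i, b), true) = - F ((i, b), false).
  have := fl i b.
  rewrite (H0 (i - 1)) ?Zn_sub1_neq // (V0 i (b - 1)) ?Zn_sub1_neq ?andbF //.
  by rewrite addr0 => /eqP; rewrite eq_sym addrC addr_eq0 => /eqP.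
have Hib : F ((i, b + 1), false) = - F ((i, b), false).
  have := fl i (b + 1).
  rewrite (H0 (i - 1)) ?Zn_sub1_neq // (V0 i (b + 1)) ?Zn_add1_neq ?andbF //.
  by rewrite addrK add0r addr0 Vib.
have Vib1 : F ((i + 1, b), true) = F ((i, b), false).
  have := fl (i + 1) b.
  rewrite (H0 (i + 1)) ?Zn_add1_neq // (V0 (i + 1) (b - 1)) ?Zn_sub1_neq ?andbF //.
  by rewrite addrK add0r addr0.
apply/ffunP=> -[[x y] s]; rewrite [RHS]ffunE squareE /=; case: s.
  case: (eqVneq y b) => [->|yb]; last by rewrite V0 ?(negPf yb) ?andbF // subrr scaler0.
  case: (eqVneq x i) => [->|xi].
    by rewrite eq_sym Zn_add1_neq Vib /= sub0r scalerN [_ *: _]mulr1.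
  case: (eqVneq x (i + 1)) => [->|xi1]; first by rewrite Vib1 subr0 [_ *: _]mulr1.
  by rewrite V0 ?(negPf xi) ?(negPf xi1) // subrr scaler0.
case: (eqVneq x i) => [->|xi]; last by rewrite H0 ?(negPf xi) // subrr scaler0.
case: (eqVneq y b) => [->|yb].
  by rewrite eq_sym Zn_add1_neq subr0 [_ *: _]mulr1.
case: (eqVneq y (b + 1)) => [->|yb1]; first by rewrite Hib sub0r scalerN [_ *: _]mulr1.
by rewrite H0 ?(negPf yb) ?(negPf yb1) ?andbF // subrr scaler0.
Qed.

End ShortCycles.

(** * Adjacency of cells *)

Section CellAdjacency.
Import GRing.Theory.
Local Open Scope ring_scope.
Variable n : nat.
Hypothesis n_ge5 : (5 <= n)%N.
Local Notation vertex := (torus_vertex n).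
Implicit Types (p q r : vertex) (x y : 'Z_n).

Definition adj p q : bool :=
  [|| q == (p.1 + 1, p.2), q == (p.1 - 1, p.2), q == (p.1, p.2 + 1)
    | q == (p.1, p.2 - 1)].

Lemma Zn_add_natr_neq (k : nat) x : (0 < k < n)%N -> (x + k%:R == x) = false.
Proof.
move=> kn; rewrite -subr_eq0 addrC addKr; apply/negbTE/Zn_natr_neq0 => //.
exact: leq_trans n_ge5.
Qed.

Lemma Zn_add2_neq x : (x + 1 + 1 == x) = false.
Proof. by rewrite -addrA (@Zn_add_natr_neq 2) //= (leq_trans _ n_ge5). Qed.

Lemma Zn_add3_neq x : (x + 1 + 1 + 1 == x) = false.
Proof. by rewrite -!addrA (@Zn_add_natr_neq 3) //= (leq_trans _ n_ge5). Qed.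

(** Keeps two steps one way from meeting two steps the other way; [adj_opposite1] and
    [adj_opposite2] fail for [n = 4]. *)
Lemma Zn_add4_neq x : (x + 1 + 1 + 1 + 1 == x) = false.
Proof. by rewrite -!addrA (@Zn_add_natr_neq 4) //= (leq_trans _ n_ge5). Qed.

Lemma Zn_eq_sub1 x y : (x == y - 1) = (x + 1 == y).
Proof. by rewrite eq_sym subr_eq eq_sym. Qed.

Lemma Zn_sub1_eq x y : (x - 1 == y) = (x == y + 1).
Proof. exact: subr_eq. Qed.

Lemma Zn_add1_inj x y : (x + 1 == y + 1) = (x == y).
Proof. exact: (inj_eq (addIr 1)). Qed.

Let neqs x := (Zn_add1_neq x, Zn_add2_neq x, Zn_add3_neq x, Zn_add4_neq x,
  etrans (eq_sym _ _) (Zn_add1_neq x), etrans (eq_sym _ _) (Zn_add2_neq x),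
  etrans (eq_sym _ _) (Zn_add3_neq x), etrans (eq_sym _ _) (Zn_add4_neq x)).

Let Zn_simp :=
  (xpair_eqE, @addrK 'Z_n, @subrK 'Z_n, eqxx, Zn_eq_sub1, Zn_sub1_eq, Zn_add1_inj, neqs).

Lemma adj_corner x y r :
  adj (x + 1, y) r -> adj (x, y + 1) r ->
  (r == (x, y)) || (r == (x + 1, y + 1)).
Proof. by rewrite /adj /= => /or4P[]/eqP->; rewrite !Zn_simp. Qed.

Lemma adj_opposite1 x y r : adj (x + 1, y) r -> adj (x - 1, y) r -> r == (x, y).
Proof. by rewrite /adj /= => /or4P[]/eqP->; rewrite !Zn_simp. Qed.

Lemma adj_opposite2 x y r : adj (x, y + 1) r -> adj (x, y - 1) r -> r == (x, y).
Proof. by rewrite /adj /= => /or4P[]/eqP->; rewrite !Zn_simp. Qed.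

Lemma adj_swap p q : adj (p.2, p.1) (q.2, q.1) = adj p q.
Proof.
case: p q => [x y] [u v]; rewrite /adj /= !xpair_eqE.
rewrite ![(v == _) && _]andbC; do !case: (_ && _) => //=.
Qed.

Definition adj_embedding (tau : vertex -> vertex) : Prop :=
  injective tau /\ forall p q, adj p q -> adj (tau p) (tau q).

Definition fixes_corner (tau : vertex -> vertex) x y : Prop :=
  [/\ tau (x, y) = (x, y), tau (x + 1, y) = (x + 1, y)
    & tau (x, y + 1) = (x, y + 1)].

(** The cell [(x + 1, y + 1)] is fixed, as the only common neighbour of two fixed cells besides the
    fixed [(x, y)]. The image of [(x + 1 + 1, y)] is then found by excluding the three other
    neighbours of [(x + 1, y)]. *)
Lemma fixes_corner_step tau x y :
  adj_embedding tau -> fixes_corner tau x y -> fixes_corner tau (x + 1) y.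
Proof.
move=> [tau_inj tauA] [t0 t1 t2].
have tau_eq p q : (tau p == tau q) = (p == q) := inj_eq tau_inj p q.
have t12 : tau (x + 1, y + 1) = (x + 1, y + 1).
  have : adj (x, y + 1) (tau (x + 1, y + 1)) by rewrite -t2 tauA // /adj eqxx.
  have : adj (x + 1, y) (tau (x + 1, y + 1)).
    by rewrite -t1 tauA // /adj eqxx !orbT.
  by move=> /adj_corner/[apply]; rewrite -{1}t0 tau_eq !Zn_simp andbF /= => /eqP.
split=> //.
have : adj (x + 1, y) (tau (x + 1 + 1, y)) by rewrite -t1 tauA // /adj eqxx.
case/or4P=> /eqP /= E //.
- by move/eqP: E; rewrite addrK -{1}t0 tau_eq !Zn_simp.
- by move/eqP: E; rewrite -t12 tau_eq !Zn_simp.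
(* If [(x + 1 + 1, y)] went to [(x + 1, y - 1)], the image of the cell above it would neighbour both
   [(x + 1, y + 1)] and [(x + 1, y - 1)], so it would be [(x + 1, y)], which is already taken. *)
- have /adj_opposite2 : adj (x + 1, y + 1) (tau (x + 1 + 1, y + 1)).
    by rewrite -t12 tauA // /adj eqxx.
  rewrite -E tauA => [/(_ isT)|]; last by rewrite /adj eqxx !orbT.
  by rewrite -t1 tau_eq !Zn_simp.
Qed.

Lemma adj_rigid tau :
  adj_embedding tau -> fixes_corner tau 0 0 -> forall p, tau p = p.
Proof.
move=> tauE t0 [x y]; suff [] : fixes_corner tau x y by [].
elim/Zn_ind: x => [|x IHx]; last exact: fixes_corner_step.
(* Vertical steps are horizontal steps of the conjugate by the exchange. *)
pose tau' p := ((tau (p.2, p.1)).2, (tau (p.2, p.1)).1).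
have tau'E : adj_embedding tau'.
  case: tauE => tau_inj tauA; split=> [[i j] [k l] [E2 E1]|p q pq].
    have /tau_inj[-> ->] // : tau (j, i) = tau (l, k).
    by rewrite (surjective_pairing (tau (j, i))) E1 E2 -surjective_pairing.
  by rewrite adj_swap tauA // adj_swap.
elim/Zn_ind: y => [|y [t00 t10 t01]]; first by [].
have [|s0 s1 s2] := @fixes_corner_step tau' y 0 tau'E.
  by split; rewrite /tau' /= ?t00 ?t10 ?t01.
have pairE u v w z :
    ((tau (u, v)).2, (tau (u, v)).1) = (w, z) :> vertex -> tau (u, v) = (z, w).
  by case: (tau (u, v)) => ? ? [-> ->].
by split; apply: pairE.
Qed.

End CellAdjacency.

(** * Classification of the isometries *)

Section Classification.
Import Order.TTheory GRing.Theory Num.Theory.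
Local Open Scope ring_scope.
Variables (R : realType) (n : nat).
Hypothesis n_ge5 : (5 <= n)%N.
Local Notation vertex := (torus_vertex n).
Local Notation efun := (edge_space R n).
Local Notation square := (square R).
Implicit Types (F : efun) (e : torus_edge n) (p q : vertex).

Lemma square_at_neq0 p x y s : (square p ((x, y), s) != 0) =
  if s then ((x == p.1 + 1) || (x == p.1)) && (y == p.2)
  else (x == p.1) && ((y == p.2) || (y == p.2 + 1)).
Proof.
rewrite squareE; case: s.
  case: (y == p.2); rewrite ?andbF ?andbT ?subrr ?eqxx //.
  case: (eqVneq x p.1) => [->|_].
    by rewrite (eq_sym p.1) Zn_add1_neq sub0r oppr_eq0 oner_eq0.
  by case: (x == _); rewrite subr0 ?oner_eq0 ?eqxx.
case: (x == p.1); rewrite /= ?subrr ?eqxx //.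
case: (eqVneq y p.2) => [->|_].
  by rewrite (eq_sym p.2) Zn_add1_neq subr0 oner_eq0.
by case: (y == _); rewrite sub0r oppr_eq0 ?oner_eq0 ?eqxx.
Qed.

Lemma card_supp_square p : (#|supp (square p)| <= 4)%N.
Proof.
pose T := [:: (p, false); ((p.1, p.2 + 1), false); (p, true); ((p.1 + 1, p.2), true)].
apply: (@leq_trans #|T|); last exact: card_size.
apply/subset_leq_card/subsetP => -[[x y] s]; rewrite inE square_at_neq0.
rewrite !inE; case: p {T} => i j /=; rewrite !xpair_eqE /=.
by case: s; rewrite /= ?andbF ?andbT ?orbF /=; do !case: (_ == _).
Qed.

Lemma square_neq0 p : square p != 0.
Proof.
apply/eqP=> sq0; have : square p (p, false) != 0.
  by case: p {sq0} => i j; rewrite square_at_neq0 !eqxx.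
by rewrite sq0 ffunE eqxx.
Qed.

Lemma shared_edge_adj p q e :
  square p e != 0 -> square q e != 0 -> (p == q) || adj p q.
Proof.
case: p q e => [i j] [k l] [[x y] s]; rewrite !square_at_neq0 /adj /= !xpair_eqE.
case: s => /andP[].
  move=> /orP[] /eqP-> /eqP-> /andP[+ /eqP<-]; rewrite ?(inj_eq (addIr 1)) eqxx !andbT.
    by case/orP=> /eqP->; rewrite ?addrK ?eqxx ?orbT.
  by case/orP=> /eqP->; rewrite ?addrK ?eqxx ?orbT.
move=> /eqP-> /orP[] /eqP-> /andP[/eqP<-]; rewrite ?(inj_eq (addIr 1)) eqxx /=.
  by case/orP=> /eqP->; rewrite ?addrK ?eqxx ?orbT.
by case/orP=> /eqP->; rewrite ?addrK ?eqxx ?orbT.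
Qed.

Lemma adj_shared_edge p q : adj p q -> exists2 e, square p e != 0 & square q e != 0.
Proof.
case: p q => [i j] [k l]; case/or4P=> /eqP[-> ->] /=.
- by exists ((i + 1, j), true); rewrite square_at_neq0 /= !eqxx ?orbT.
- by exists ((i, j), true); rewrite square_at_neq0 /= ?subrK !eqxx ?orbT.
- by exists ((i, j + 1), false); rewrite square_at_neq0 /= !eqxx ?orbT.
- by exists ((i, j), false); rewrite square_at_neq0 /= ?subrK !eqxx ?orbT.
Qed.

Lemma adj_irrefl p : adj p p = false.
Proof.
case: p => i j; rewrite /adj /= !xpair_eqE !eqxx !andbT.
by rewrite !(eq_sym i) !(eq_sym j) !Zn_add1_neq !Zn_sub1_neq.
Qed.

(** The bottom edges alone give the same column and heights differing by at most one each way; a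
    difference of exactly one would force [l = l + 1 + 1]. *)
Lemma square_supp_inj p q :
  (forall e, (square p e != 0) = (square q e != 0)) -> p = q.
Proof.
case: p q => [i j] [k l] E.
have := E ((i, j), false); rewrite !square_at_neq0 /= !eqxx => /esym/andP[/eqP ik jl].
rewrite -{k}ik in E *.
have := E ((i, l), false); rewrite !square_at_neq0 /= !eqxx /= => lj.
congr (_, _); case/orP: jl => /eqP // jl; move: lj; rewrite jl.
by rewrite ![l == _]eq_sym Zn_add1_neq (Zn_add2_neq n_ge5).
Qed.

Definition tracks (g : 'End(efun)) (tau : vertex -> vertex) : Prop :=
  forall p, exists a : R, g (square p) = a *: square (tau p).

(** A signed permutation keeps the size of the support, so the image of a square is a nonzero cycle
    on at most four edges. *)
Lemma isometry_tracks g : torus_isometry g -> exists tau, tracks g tau.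
Proof.
move=> gI; suff /fin_all_exists[tau tauP] p :
    exists q, exists a : R, g (square p) = a *: square q.
  by exists tau.
have [pi [s [pi_inj s2 gE]]] := l1isometry_monomial (proj1 gI).
apply: (four_edge_cycle n_ge5); first by apply: isometry_cycle => //; exact: curl_cycle.
  by rewrite -[0](linear0 g) (inj_eq (isometry_inj gI)) square_neq0.
apply: leq_trans (card_supp_square p); rewrite -[leqRHS](card_imset _ pi_inj).
have [pi' _ piK] := injF_bij pi_inj.
apply/subset_leq_card/subsetP=> f; rewrite inE -[f]piK. rewrite gE => sF.
by rewrite imset_f // inE; apply: contraNneq sF => ->; rewrite mulr0.
Qed.

Lemma tracks_supp (g : 'End(efun)) tau p e (pi : torus_edge n -> torus_edge n)
    (s : torus_edge n -> R) :
  (forall e, s e ^+ 2 = 1) -> (forall F e, g F (pi e) = s e * F e) ->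
  tracks g tau -> square p e != 0 -> square (tau p) (pi e) != 0.
Proof.
move=> s2 gE /(_ p)[a ga] pe.
have : g (square p) (pi e) != 0.
  rewrite gE mulf_neq0 //; apply/eqP=> se0; have /eqP := s2 e.
  by rewrite se0 expr0n eq_sym oner_eq0.
by rewrite ga ffunE; apply: contraNneq => ->; rewrite scaler0.
Qed.

(** Squares with proportional images have equal supports, which gives injectivity. Adjacent cells
    share an edge, and [pi] carries it to an edge shared by the image cells. *)
Lemma tracks_embedding g tau : torus_isometry g -> tracks g tau -> adj_embedding tau.
Proof.
move=> gI gtau.
have [pi [s [pi_inj s2 gE]]] := l1isometry_monomial (proj1 gI).
have tau_inj : injective tau.
  move=> p q pq; have [[a ga] [b gb]] := (gtau p, gtau q).
  have nz c r : g (square r) = c *: square (tau r) -> c != 0.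
    move=> gr; apply/eqP=> c0; move/eqP: (square_neq0 r); apply.
    by apply: (isometry_inj gI); rewrite gr c0 scale0r linear0.
  have a0 := nz _ _ ga; have b0 := nz _ _ gb.
  have E : b *: square p = a *: square q.
    apply: (isometry_inj gI); rewrite !linearZ /= ga gb pq.
    by rewrite !scalerA mulrC.
  apply: square_supp_inj => e; have := congr1 (fun F : efun => F e == 0) E.
  by rewrite !ffunE !scaler_eq0 (negPf a0) (negPf b0) /= => ->.
split=> // p q pq; have [e pe qe] := adj_shared_edge pq.
have := shared_edge_adj (tracks_supp s2 gE gtau pe) (tracks_supp s2 gE gtau qe).
rewrite (inj_eq tau_inj); case: eqP => // E; by rewrite E adj_irrefl in pq.
Qed.

(** [q] is the cell on the other side of [e]. *)
Lemma shared_edge_uniq e f x y : e.1 = (x, y) ->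
  let q := if e.2 then (x - 1, y) else (x, y - 1) in
  square (x, y) f != 0 -> square q f != 0 -> f = e.
Proof.
case: e f => [[x' y'] s] [[u v] t] /= [-> ->]; rewrite !square_at_neq0 /=.
case: s t => -[] /=; rewrite ?subrK.
- move=> /andP[/orP[]/eqP-> /eqP->]; last by [].
  by rewrite Zn_add1_neq Zn_eq_sub1 (Zn_add2_neq n_ge5).
- by move=> /andP[/eqP-> _] /andP[]; rewrite eq_sym Zn_sub1_neq.
- by move=> /andP[_ /eqP->] /andP[_]; rewrite eq_sym Zn_sub1_neq.
- move=> /andP[/eqP-> /orP[]/eqP->]; first by [].
  by rewrite Zn_add1_neq Zn_eq_sub1 (Zn_add2_neq n_ge5) andbF.
Qed.

(* Every edge is the only common edge of its two cells, so an isometry mapping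
   each square to a multiple of itself is diagonal in the edge basis, and the
   diagonal entry is the same for two edges of a common square. *)
Lemma tracks_id_scalar g :
  torus_isometry g -> tracks g id -> exists c : R, forall F, g F = c *: F.
Proof.
move=> gI gid; have [pi [s [pi_inj s2 gE]]] := l1isometry_monomial (proj1 gI).
have [a aE] := fin_all_exists gid.
pose twin e : vertex := if e.2 then (e.1.1 - 1, e.1.2) else (e.1.1, e.1.2 - 1).
have sq1 e : square e.1 e != 0.
  by case: e => [[x y] []]; rewrite square_at_neq0 !eqxx ?orbT.
have sq2 e : square (twin e) e != 0.
  by case: e => [[x y] []]; rewrite square_at_neq0 /= !subrK !eqxx ?orbT.
have pi_id e : pi e = e.
  apply: (@shared_edge_uniq e (pi e) e.1.1 e.1.2); first by case: e => [[]].
    rewrite -surjective_pairing; exact: tracks_supp s2 gE gid (sq1 e).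
  exact: tracks_supp s2 gE gid (sq2 e).
have sa p e : square p e != 0 -> s e = a p.
  move=> pe; apply: (mulIf pe); rewrite -gE pi_id aE ffunE.
  by [].
have a_const p : a p = a (0, 0).
  case: p => i j; rewrite (@Zn_step_const n _ (fun k => a (k, j))) => [|k].
    apply: (@Zn_step_const n _ (fun l => a (0, l))) => l.
    by rewrite -(sa _ _ (sq1 ((0, l), false))) -(sa _ _ (sq2 ((0, l), false))).
  by rewrite -(sa _ _ (sq1 ((k, j), true))) -(sa _ _ (sq2 ((k, j), true))).
exists (a (0, 0)) => F; apply/ffunP=> e.
by rewrite -{1}(pi_id e) gE (sa _ _ (sq1 e)) a_const ffunE.
Qed.

(** Functions are pulled back, so squares move by the inverse of [gen_cell x]. *)
Definition gen_push (x : torus_gen n) p : vertex :=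
  match x with
  | TShift a => p + a
  | TSwap => (p.2, p.1)
  | TReflect => (- p.1, p.2)
  end.

Lemma gen_act_square x p :
  gen_act x (square p) = (-1) ^+ gen_cell_neg x *: square (gen_push x p).
Proof.
rewrite /square gen_act_curl -linearZ; congr curl; apply/ffunP=> q.
rewrite !ffunE; congr (_ * _%:R); congr (nat_of_bool _).
case: x => [a||] /=; first by rewrite subr_eq.
  by case: p q => [i j] [k l]; rewrite !xpair_eqE andbC.
by case: p q => [i j] [k l]; rewrite !xpair_eqE eqr_oppLR.
Qed.

Lemma tracks_gen x g tau :
  tracks g tau -> tracks (linfun (gen_act x) \o g)%VF (gen_push x \o tau).
Proof.
move=> gtau p; have [a ga] := gtau p; exists (a * (-1) ^+ gen_cell_neg x).
by rewrite comp_lfunE ga linearZ /= lfunE /= gen_act_square scalerA.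
Qed.

(** Descending from the composite to [g] avoids inverting generators. Successive compositions make
    [tau] fix [(0, 0)], then [(1, 0)], then [(0, 1)]; rigidity then leaves a scalar. *)
Lemma isometry_ind (C : 'End(efun) -> Prop) :
  (forall (g : 'End(efun)) (c : R), (forall F, g F = c *: F) -> C g) ->
  (forall x g, torus_isometry g -> C (linfun (gen_act x) \o g)%VF -> C g) ->
  forall g, torus_isometry g -> C g.
Proof.
move=> Cscalar Cgen.
have Cpush x g tau : torus_isometry g -> tracks g tau ->
    (torus_isometry (linfun (gen_act x) \o g)%VF ->
     tracks (linfun (gen_act x) \o g)%VF (gen_push x \o tau) ->
     C (linfun (gen_act x) \o g)%VF) -> C g.
  move=> gI gtau Cxg; apply: (Cgen x) => //; apply: Cxg.
    by apply: isometry_comp => //; apply: gen_isometry.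
  exact: tracks_gen.
have Cid g tau : torus_isometry g -> tracks g tau -> fixes_corner tau 0 0 -> C g.
  move=> gI gtau tau0; have tauE := tracks_embedding gI gtau.
  have gid : tracks g id by move=> p; rewrite -{2}[p](adj_rigid n_ge5 tauE tau0).
  by have [c /Cscalar] := tracks_id_scalar gI gid.
have Caxis g tau : torus_isometry g -> tracks g tau -> tau (0, 0) = (0, 0) ->
    tau (0 + 1, 0) = (0 + 1, 0) -> C g.
  move=> gI gtau t0 t1; have tauE := tracks_embedding gI gtau.
  have [tau_inj tauA] := tauE.
  have : adj (0, 0) (tau (0, 0 + 1)) by rewrite -t0 tauA // /adj eqxx !orbT.
  case/or4P=> /eqP /= t2.
  - by rewrite -t1 in t2; case/eqP: (tau_inj _ _ t2); rewrite xpair_eqE eq_sym Zn_add1_neq.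
  (* Here [(1, 0)] and [(0, 1)] would go to opposite neighbours of the origin, whose only common
     neighbour, the origin, is taken. *)
  - have t12 : tau (0 + 1, 0 + 1) = (0, 0).
      apply/eqP/(adj_opposite1 n_ge5); first by rewrite -t1 tauA // /adj eqxx !orbT.
      by rewrite -t2 tauA // /adj eqxx.
    rewrite -t0 in t12; case/eqP: (tau_inj _ _ t12).
    by rewrite xpair_eqE Zn_add1_neq.
  - exact: Cid gtau _.
  (* The reflection of the second coordinate is [TReflect] conjugated by the exchange. *)
  - apply: (Cpush TSwap _ _ gI gtau) => g1I g1tau.
    apply: (Cpush TReflect _ _ g1I g1tau) => g2I g2tau.
    apply: (Cpush TSwap _ _ g2I g2tau) => g3I g3tau.
    by apply: (Cid _ _ g3I g3tau); split;
      rewrite /= ?t0 ?t1 ?t2 /= ?oppr0 ?sub0r ?opprK ?add0r.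
have Corigin g tau : torus_isometry g -> tracks g tau -> tau (0, 0) = (0, 0) -> C g.
  move=> gI gtau t0; have [_ tauA] := tracks_embedding gI gtau.
  have : adj (0, 0) (tau (0 + 1, 0)) by rewrite -t0 tauA // /adj eqxx.
  case/or4P=> /eqP /= t1.
  - exact: Caxis gtau _ _.
  - apply: (Cpush TReflect _ _ gI gtau) => g1I g1tau.
    by apply: (Caxis _ _ g1I g1tau); rewrite /= ?t0 ?t1 /= ?oppr0 ?sub0r ?opprK ?add0r.
  - apply: (Cpush TSwap _ _ gI gtau) => g1I g1tau.
    by apply: (Caxis _ _ g1I g1tau); rewrite /= ?t0 ?t1.
  - apply: (Cpush TSwap _ _ gI gtau) => g1I g1tau.
    apply: (Cpush TReflect _ _ g1I g1tau) => g2I g2tau.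
    by apply: (Caxis _ _ g2I g2tau); rewrite /= ?t0 ?t1 /= ?oppr0 ?sub0r ?opprK ?add0r.
move=> g gI; have [tau gtau] := isometry_tracks gI.
apply: (Cpush (TShift (- tau (0, 0) : vertex)) _ _ gI gtau) => g1I g1tau.
by apply: (Corigin _ _ g1I g1tau); rewrite /= subrr.
Qed.

End Classification.

(** * Invariant maps as convolutions *)

Section InvariantMaps.
Import Order.TTheory GRing.Theory Num.Theory.
Local Open Scope ring_scope.
Variables (R : realType) (n : nat).
Hypothesis n_ge5 : (5 <= n)%N.
Local Notation vertex := (torus_vertex n).
Local Notation vfun := {ffun torus_vertex n -> R^o}.
Local Notation efun := (edge_space R n).
Local Notation Z := (cycle_space R n).
Local Notation B := (cut_space R n).
Implicit Types (F : efun) (f h : vfun) (v p : vertex) (A : cut_to_cycle R n).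

(** The reflection fixing the vertex [0] sends the cell column [i] to [- 1 - i]. These two rules
    generate the sign action of the dihedral stabiliser of that vertex. *)
Definition cell_alternating h : Prop :=
  (forall i j, h (- 1 - i, j) = - h (i, j)) /\ (forall i j, h (j, i) = - h (i, j)).

Lemma cell_alternating2 h i j : cell_alternating h -> h (i, - 1 - j) = - h (i, j).
Proof. by case=> h1 h2; rewrite h2 h1 opprK h2. Qed.

Lemma eq_opp0 (c : R) : c = - c -> c = 0.
Proof.
move/eqP; rewrite -addr_eq0 -mulr2n mulrn_eq0 /= => /eqP //.
Qed.

Lemma cell_alternating_sum h : cell_alternating h -> \sum_v h v = 0.
Proof.
case=> _ h2; apply: eq_opp0; rewrite -sumrN.
have swI : injective (fun v : vertex => (v.2, v.1) : vertex).
  by move=> [i j] [k l] [-> ->].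
by rewrite (reindex_inj swI); apply: eq_bigr => -[i j] _ /=; rewrite h2.
Qed.

Lemma gen_vertex_inj x : injective (@gen_vertex n x).
Proof.
case: x => [a||] [i j] [k l] /=; first exact: (addIr (- a)).
  by case=> -> ->.
by move=> /[dup] /(congr1 snd) /= -> /(congr1 fst) /= /addrI/oppr_inj->.
Qed.

(** For the reflection, [- i - (1 - k) = - 1 - (i - k)]: subtracting a reflected vertex from a
    reflected cell reflects the difference about the vertex [0], where [h] is odd. *)
Lemma conv_gen x h f : cell_alternating h ->
  conv h (gen_vact x f) = gen_cact x (conv h f).
Proof.
move=> hA; have [h1 h2] := hA; apply/ffunP=> p; rewrite !ffunE.
rewrite [in RHS](reindex_inj (@gen_vertex_inj x)) mulr_sumr.
apply: eq_bigr => v _; rewrite ffunE mulrA; congr (_ * _).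
case: x p v => [a||] [i j] [k l] /=; rewrite ?expr0 ?expr1 ?mul1r ?mulN1r.
- by congr (h _); congr (_, _); ring.
- exact: h2.
- rewrite -h1; congr (h _); congr (_, _) => /=; ring.
Qed.

Lemma conv_cst h f : cell_alternating h -> (forall v, f v = f (0, 0)) -> conv h f = 0.
Proof.
move=> hA f0; apply/ffunP=> p; rewrite !ffunE.
under eq_bigr => v _ do rewrite f0.
rewrite -mulr_suml; have subI : injective (fun v : vertex => p - v : vertex).
  by move=> u v /addrI/oppr_inj.
by have := cell_alternating_sum hA; rewrite (reindex_inj subI) => ->; rewrite mul0r.
Qed.

Lemma conv_eq_grad h f f' : cell_alternating h ->
  grad f = grad f' -> conv h f = conv h f'.
Proof.
move=> hA ff'; apply/eqP; rewrite -subr_eq0 -linearB /= conv_cst //.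
by apply: grad_eq0; rewrite linearB /= ff' subrr.
Qed.

(** The inverse of [grad] picks some potential of the cut; for alternating [h] the choice is
    immaterial, as [conv h] kills constants. *)
Definition conv_map h : cut_to_cycle R n :=
  (linfun (vsproj Z) \o (linfun (@curl R n) \o (linfun (conv h) \o
    ((linfun (@grad R n))^-1 \o linfun vsval))))%VF.

Lemma conv_mapE h (b : subvs_of B) f : cell_alternating h -> vsval b = grad f ->
  vsval (conv_map h b) = curl (conv h f).
Proof.
move=> hA bf; rewrite !comp_lfunE !lfunE /= vsprojK ?curl_cycle // bf.
congr curl; apply: conv_eq_grad => //.
by rewrite -[grad (_ _)]lfunE limg_lfunVK // -[grad f]lfunE memv_img ?memvf.
Qed.

(** The classification reduces this to scalars and generators, and each generator intertwines
    [grad], [conv h] and [curl]. *)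
Lemma conv_isometry h g f f' : cell_alternating h -> torus_isometry g ->
  g (grad f) = grad f' -> g (curl (conv h f)) = curl (conv h f').
Proof.
move=> hA gI; move: g gI f f'.
apply: (isometry_ind n_ge5) => [g c gc|x g gI IH] f f' gf.
  rewrite gc -!linearZ; congr curl; apply: conv_eq_grad => //.
  by rewrite linearZ -gf gc.
apply: (isometry_inj (gen_isometry R x)).
rewrite -comp_lfunE (IH f (gen_vact x f')); last first.
  by rewrite comp_lfunE gf lfunE /= gen_act_grad.
by rewrite lfunE /= gen_act_curl conv_gen.
Qed.

Lemma conv_map_invariant h : cell_alternating h -> invariant_map (conv_map h).
Proof.
move=> hA g gI b; have /cut_spaceP[f bf] := subvsP b.
have gbB := isometry_cut gI (subvsP b); have /cut_spaceP[f' gbf] := gbB.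
rewrite (conv_mapE hA bf) (conv_isometry (f' := f') hA gI); last by rewrite -bf.
by apply: conv_mapE => //; rewrite vsprojK.
Qed.

Definition Zn_primitive (G : 'Z_n -> R) (j : 'Z_n) : R :=
  \sum_(l : 'Z_n | (l <= j)%N) G l.

(** The zero sum is what makes the step from the last residue back to [0] consistent. *)
Lemma Zn_primitiveE G j : \sum_l G l = 0 ->
  Zn_primitive G (j + 1) - Zn_primitive G j = G (j + 1).
Proof.
move=> G0; rewrite /Zn_primitive.
have vj : (j + 1 : 'Z_n) = (j.+1 %% (Zp_trunc n).+2)%N :> nat.
  by rewrite /= modnDmr addn1.
case: (ltngtP j.+1 (Zp_trunc n).+2) => jn; last 1 first.
- have -> : j + 1 = 0 by apply: ord_inj; rewrite vj jn modnn.
  rewrite (bigD1 0) //= big1 ?addr0 => [|l /andP[l0 l0']].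
    by rewrite (eq_bigl predT) ?G0 ?subr0 // => l; rewrite -ltnS jn ltn_ord.
  by case/negP: l0'; rewrite -val_eqE /= -leqn0.
- rewrite (bigD1 (j + 1)) // -[RHS]addr0 -addrA; congr (_ + _).
  apply/eqP; rewrite subr_eq0; apply/eqP/eq_bigl => l.
  by rewrite -(inj_eq (@ord_inj _)) vj modn_small // andbC -ltn_neqAle ltnS.
- by have := ltn_ord j; rewrite -ltnS ltnNge jn.
Qed.

(* [h] is the primitive of the horizontal part of [F] in the second coordinate,
   normalised by [h (i, -1) = - h (i, 0)]. *)
Lemma alternating_potential F :
  F \in Z -> (forall i j, F ((- 1 - i, j), false) = - F ((i, j), false)) ->
  (forall i j, F ((i, - j), false) = F ((i, j), false)) ->
  (forall i j, F ((i, j), true) = F ((j, i), false)) ->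
  exists2 h, cell_alternating h & F = curl h.
Proof.
move=> /mem_cycle_space fl Fodd Feven Fswap.
(* The flux is independent of the column and odd under [i -> - 1 - i]. *)
have Hflux i : \sum_j F ((i, j), false) = 0.
  have flux := @flow_flux _ _ (fun i j => F ((i, j), false))
    (fun i j => F ((i, j), true)) fl.
  have E : \sum_j F ((-1 - 0, j), false) = - \sum_j F ((0, j), false).
    by rewrite -sumrN; apply: eq_bigr => j _; rewrite Fodd.
  by rewrite flux; apply: eq_opp0; rewrite -{1}E flux.
pose G i j := F ((i, j), false); pose S i := Zn_primitive (G i).
pose h : vfun := [ffun p => S p.1 p.2 - S p.1 0 + G p.1 0 / 2].
have hS i j : h (i, j) - h (i, j - 1) = G i j.
  have := Zn_primitiveE (j - 1) (Hflux i).
  by rewrite subrK /G !ffunE /= => <-; rewrite -!/(G _ _) /S; ring.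
have h0 i : h (i, 0) + h (i, 0) = G i 0.
  by rewrite !ffunE /= subrr add0r -splitr.
have h1 i j : h (- 1 - i, j) = - h (i, j).
  have Sodd l : S (- 1 - i) l = - S i l.
    by rewrite /S /Zn_primitive -sumrN; apply: eq_bigr => k _; rewrite /G Fodd.
  by rewrite !ffunE /= !Sodd /G Fodd; ring.
(* Evenness of [F] makes the sum [h (i, - 1 - j) + h (i, j)] constant in [j]; the normalisation
   makes it vanish at [j = 0]. *)
have h3 i j : h (i, - 1 - j) = - h (i, j).
  apply/eqP; rewrite -addr_eq0; apply/eqP.
  rewrite (@Zn_step_const n _ (fun j => h (i, - 1 - j) + h (i, j))) => [|k].
    have := hS i 0; rewrite -(h0 i) !sub0r subr0 => E.
    have -> : h (i, - 1) = h (i, 0) - (h (i, 0) - h (i, - 1)) by rewrite opprB addrC subrK.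
    by rewrite E opprD addrA subrr add0r addNr.
  have -> : - 1 - (k - 1) = - k by ring.
  have -> : h (i, - k) = G i (- k) + h (i, - 1 - k) by rewrite -hS [- k - 1]addrC subrK.
  rewrite /G Feven -/(G i k) -(hS i k); ring.
(* For the symmetric part [q], conservation makes [q k (l - 1) - q k l] independent of [k], so
   oddness in [k] makes it zero. Then [q] is constant and odd in [l]. *)
have q0 i j : h (i, j) + h (j, i) = 0.
  pose q i j := h (i, j) + h (j, i).
  have qodd1 k l : q (- 1 - k) l = - q k l by rewrite /q h1 h3 opprD.
  have qodd2 k l : q k (- 1 - l) = - q k l by rewrite /q h1 h3 opprD.
  have qstep k l : q k (l - 1) = q k l.
    apply/eqP; rewrite -subr_eq0; apply/eqP.
    pose r k := q k (l - 1) - q k l.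
    have r_const : forall k, r k = r 0.
      apply: Zn_step_const => {}k; have := fl k l; rewrite !Fswap.
      rewrite -/(G _ _) -/(G _ _) -/(G _ _) -/(G _ _) -!hS => E.
      apply/eqP; rewrite -subr_eq0; apply/eqP; rewrite /r /q.
      rewrite -[RHS]oppr0; move/eqP: E; rewrite -subr_eq0 => /eqP <-; ring.
    rewrite -/(r k) r_const; apply: eq_opp0.
    by rewrite -{1}(r_const (- 1 - 0)) /r !qodd1; ring.
  rewrite -/(q i j) (@Zn_step_const n _ (q i) (qstep i)); apply: eq_opp0.
  by rewrite -qodd2 [RHS](@Zn_step_const n _ (q i) (qstep i)).
have h2 i j : h (j, i) = - h (i, j).
  by apply/eqP; rewrite -addr_eq0 q0.
exists h => //; apply/ffunP=> -[[i j] s]; rewrite [RHS]ffunE /=; case: s.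
  by rewrite Fswap -/(G j i) -hS (h2 i j) (h2 (i - 1) j) opprK addrC.
by rewrite hS.
Qed.

End InvariantMaps.

(** * Dimension and projections *)

Section Parametrisation.
Import Order.TTheory GRing.Theory Num.Theory.
Local Open Scope ring_scope.
Variables (R : realType) (n : nat).
Hypothesis n_ge5 : (5 <= n)%N.
Local Notation vertex := (torus_vertex n).
Local Notation vfun := {ffun torus_vertex n -> R^o}.
Local Notation efun := (edge_space R n).
Local Notation Z := (cycle_space R n).
Local Notation B := (cut_space R n).
Implicit Types (F : efun) (f h : vfun) (v p : vertex) (A : cut_to_cycle R n).
Implicit Types (i j : 'Z_n).

Lemma delta_shift v : delta R v = gen_vact (TShift v) (delta R (0, 0)).
Proof. by apply/ffunP=> u; rewrite !ffunE -[RHS]/((u - v == 0)%:R) subr_eq0. Qed.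

Lemma conv_delta0 h : conv h (delta R (0, 0)) = h.
Proof. by apply/ffunP=> p; rewrite conv_delta ffunE -[(0, 0)]/(0 : vertex) subr0. Qed.

Lemma invariant_map_conv A : invariant_map A ->
  exists2 h, cell_alternating h & A = conv_map h.
Proof.
move=> Ainv; pose M f := vsval (A (vsproj B (grad f))).
have gradB f : grad f \in B by apply/cut_spaceP; exists f.
have M_gen x f : M (gen_vact x f) = gen_act x (M f).
  have := Ainv _ (gen_isometry R x) (vsproj B (grad f)).
  by rewrite vsprojK // !lfunE /= gen_act_grad.
pose F := M (delta R (0, 0)).
have F_swap i j : F ((i, j), true) = F ((j, i), false).
  have /ffunP/(_ ((i, j), true)) : F = gen_act TSwap F.
    rewrite -M_gen; congr M; apply/ffunP=> -[k l].
    by rewrite !ffunE !xpair_eqE andbC.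
  by rewrite ffunE /= expr0 mul1r.
(* [TReflect] moves the vertex [(0, 0)] to [(1, 0)], so it acts on [delta] at the origin as the
   translation does. *)
have F_refl : gen_act TReflect F = gen_act (TShift ((1, 0) : vertex)) F.
  rewrite -!M_gen; congr M; apply/ffunP=> -[k l].
  rewrite !ffunE /= !xpair_eqE subr0.
  by rewrite subr_eq add0r eq_sym subr_eq0.
have back k l : ((k + 1, l) : vertex) - ((1, 0) : vertex) = (k, l).
  by rewrite -[LHS]/(k + 1 - 1, l - 0) addrK subr0.
have [||||h hA Fh] := @alternating_potential R n F.
- exact: subvsP.
- move=> i j; have /ffunP/(_ ((i + 1, j), false)) := F_refl.
  rewrite !ffunE /= expr1 mulN1r mul1r back => <-.
  by rewrite opprK opprD addrC.
- move=> i j; rewrite -!F_swap; have /ffunP/(_ ((j + 1, i), true)) := F_refl.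
  by rewrite !ffunE /= !mul1r back opprD addrC subrK.
- exact: F_swap.
exists h => //; apply/lfunP=> b; apply: subvs_inj.
have /cut_spaceP[f bf] := subvsP b; rewrite (conv_mapE hA bf).
(* Translations reach every [delta v] from the origin, and these functions span. *)
have M_delta v : M (delta R v) = curl (conv h (delta R v)).
  rewrite delta_shift M_gen conv_gen // conv_delta0 -gen_act_curl.
  by rewrite -Fh.
rewrite -[b]vsvalK bf -/(M f) {2}[f]sum_delta !linear_sum.
have -> : M f = \sum_v f v *: M (delta R v).
  rewrite /M {1}[f]sum_delta !linear_sum; apply: eq_bigr => v _.
  by rewrite !linearZ.
by apply: eq_bigr => v _; rewrite M_delta !linearZ.
Qed.

(** Representatives of the cell orbits with trivial stabiliser under the exchange and the
    reflections [i -> - 1 - i]; an alternating function vanishes on all other cells. *)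
Definition half_triangle : pred vertex := [pred p : vertex | (p.1 < p.2 < n %/ 2)%N].

Local Notation params := {ffun {p | half_triangle p} -> R^o}.
Implicit Type u : params.

Definition triangle_ext u p : R := if insub p is Some k then u k else 0.

Definition square_ext u i j : R :=
  triangle_ext u (i, j) - triangle_ext u (j, i).

(** If both coordinates are below [n %/ 2], only the first term survives, since [- 1 - i] then lies
    outside that range. *)
Definition alternating_ext u : vfun :=
  [ffun p => square_ext u p.1 p.2 - square_ext u (- 1 - p.1) p.2
             - square_ext u p.1 (- 1 - p.2) + square_ext u (- 1 - p.1) (- 1 - p.2)].

Lemma alternating_extP u : cell_alternating (alternating_ext u).
Proof.
have K (i : 'Z_n) : - 1 - (- 1 - i) = i by rewrite opprB addrC subrK.
split=> i j; rewrite !ffunE /= ?K; first by ring.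
rewrite /square_ext; ring.
Qed.

Lemma triangle_ext_linear a u u' p :
  triangle_ext (a *: u + u') p = a * triangle_ext u p + triangle_ext u' p.
Proof.
rewrite /triangle_ext; case: insub => [k|]; first by rewrite !ffunE.
by rewrite mulr0 addr0.
Qed.

Lemma alternating_ext_linear a u u' :
  alternating_ext (a *: u + u') = a *: alternating_ext u + alternating_ext u'.
Proof.
apply/ffunP=> p; rewrite !ffunE /square_ext !triangle_ext_linear.
by rewrite -[a *: _]/(a * _); ring.
Qed.

Lemma Zn_ltn (i : 'Z_n) : (i < n)%N.
Proof. by rewrite -[X in (_ < X)%N](@Zp_cast n) ?ltn_ord // (leq_trans _ n_ge5). Qed.

Lemma Zn_reflectE (i : 'Z_n) : (- 1 - i : 'Z_n) = (n.-1 - i)%N :> nat.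
Proof.
have n1 : (1 < n)%N by exact: leq_trans n_ge5.
have n0 : (0 < n)%N by exact: ltnW.
have E : (n.-1 - i)%:R + i + 1 = 0 :> 'Z_n.
  rewrite -{2}[i]natr_Zp -natrD subnK; last by rewrite -ltnS prednK // Zn_ltn.
  by rewrite natr1 prednK //; apply: ord_inj; rewrite val_Zp_nat // modnn.
have -> : - 1 - i = (n.-1 - i)%:R :> 'Z_n.
  by apply/eqP; rewrite eq_sym -opprD -addr_eq0 [1 + i]addrC addrA E.
by rewrite val_Zp_nat // modn_small // (leq_ltn_trans (leq_subr _ _)) // ltn_predL.
Qed.

Lemma Zn_half_reflect (i : 'Z_n) : (i < n %/ 2)%N -> ((- 1 - i)%R < n %/ 2)%N = false.
Proof. by rewrite Zn_reflectE => ?; lia. Qed.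

(** This occurs only for odd [n], at the middle residue. *)
Lemma Zn_half_center (i : 'Z_n) : (n %/ 2 <= i)%N -> (n %/ 2 <= (- 1 - i)%R)%N ->
  - 1 - i = i.
Proof.
move=> i1 i2; apply: ord_inj; move: i2; have := Zn_ltn i.
by rewrite Zn_reflectE => ? ?; lia.
Qed.

Lemma triangle_ext_out u i j : ~~ (i < j < n %/ 2)%N -> triangle_ext u (i, j) = 0.
Proof. by move=> ij_out; rewrite /triangle_ext insubN. Qed.

Lemma square_ext_out u i j :
  ~~ ((i < n %/ 2)%N && (j < n %/ 2)%N) -> square_ext u i j = 0.
Proof.
move=> ij; rewrite /square_ext !triangle_ext_out ?subr0 //.
  by apply: contra ij => /= /andP[ji im]; rewrite im (ltn_trans ji im).
by apply: contra ij => /= /andP[ij jm]; rewrite jm (ltn_trans ij jm).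
Qed.

Lemma alternating_ext_val u k : alternating_ext u (val k) = u k.
Proof.
rewrite ffunE; case: k => -[i j] /= ijm; have /andP[/= ij jm] := ijm.
have im := ltn_trans ij jm.
rewrite (@square_ext_out _ i (- 1 - j)) ?(Zn_half_reflect jm) ?andbF //.
rewrite !(@square_ext_out _ (- 1 - i)) ?(Zn_half_reflect im) //.
rewrite !subr0 addr0 /square_ext (@triangle_ext_out _ j i) /=; last first.
  by rewrite ltnNge (ltnW ij).
by rewrite subr0 /triangle_ext insubT.
Qed.

(** Reflections bring each coordinate below [n %/ 2] unless it is the middle one, where [h] is its
    own negative. *)
Lemma alternating_ext_surj h : cell_alternating h -> exists u, h = alternating_ext u.
Proof.
move=> hA; have [h1 h2] := hA; have h3 i j := @cell_alternating2 _ _ h i j hA.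
pose u : params := [ffun k => h (val k)]; exists u.
have sqE i j : (i < n %/ 2)%N -> (j < n %/ 2)%N -> square_ext u i j = h (i, j).
  move=> im jm; rewrite /square_ext; case: (ltngtP i j) => [ij|ji|/ord_inj ij].
  - rewrite (@triangle_ext_out _ j i) /= ?subr0; last by rewrite ltnNge (ltnW ij).
    have ijm : half_triangle (i, j) by apply/andP.
    by rewrite /triangle_ext insubT ffunE.
  - rewrite (@triangle_ext_out _ i j) /= ?sub0r; last by rewrite ltnNge (ltnW ji).
    have jim : half_triangle (j, i) by apply/andP.
    by rewrite /triangle_ext insubT ffunE -h2.
  - by rewrite -ij subrr; apply/esym/eq_opp0; rewrite -h2.
apply/ffunP=> -[i j]; rewrite ffunE /=.
have [im|im] := ltnP i (n %/ 2).
  rewrite !(@square_ext_out _ (- 1 - i)) ?(Zn_half_reflect im) // subr0 addr0.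
  have [jm|jm] := ltnP j (n %/ 2).
    by rewrite (@square_ext_out _ i (- 1 - j)) ?(Zn_half_reflect jm) ?andbF // subr0 sqE.
  rewrite (@square_ext_out _ i j) ?im -?leqNgt // sub0r.
  have [jm'|jm'] := ltnP (- 1 - j)%R (n %/ 2); first by rewrite sqE // h3 opprK.
  rewrite square_ext_out ?oppr0 ?im -?leqNgt //; apply: eq_opp0.
  by rewrite -h3 Zn_half_center.
rewrite !(@square_ext_out _ i) -?leqNgt ?negb_and -?leqNgt ?im // !sub0r subr0.
have [im'|im'] := ltnP (- 1 - i)%R (n %/ 2); last first.
  rewrite !(@square_ext_out _ (- 1 - i)) ?negb_and -?leqNgt ?im' // oppr0 addr0.
  by apply: eq_opp0; rewrite -h1 Zn_half_center.
have [jm|jm] := ltnP j (n %/ 2).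
  rewrite (@square_ext_out _ (- 1 - i) (- 1 - j)) ?(Zn_half_reflect jm) ?andbF //.
  by rewrite addr0 sqE // h1 opprK.
rewrite (@square_ext_out _ (- 1 - i) j) ?im' -?leqNgt // oppr0 add0r.
have [jm'|jm'] := ltnP (- 1 - j)%R (n %/ 2); first by rewrite sqE // h1 h3 opprK.
rewrite square_ext_out ?im' -?leqNgt //; apply: eq_opp0.
by rewrite -h3 Zn_half_center.
Qed.

Lemma conv_mapPl a h h' : conv_map (a *: h + h') = a *: conv_map h + conv_map h'.
Proof.
apply/lfunP=> b; rewrite add_lfunE scale_lfunE /conv_map !comp_lfunE !lfunE /=.
by rewrite convPl !linearP.
Qed.

Definition param_map u : cut_to_cycle R n := conv_map (alternating_ext u).

Fact param_map_linear : linear param_map.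
Proof. by move=> a u u'; rewrite /param_map alternating_ext_linear conv_mapPl. Qed.
HB.instance Definition _ :=
  GRing.isLinear.Build R params (cut_to_cycle R n) _ param_map param_map_linear.

(** Zero curl makes [h] constant in the second coordinate, in which it is also odd. *)
Lemma curl_inj_alternating h : cell_alternating h -> curl h = 0 -> h = 0.
Proof.
move=> hA h0; apply/ffunP=> -[i j]; rewrite [RHS]ffunE.
have hc l : h (i, l - 1) = h (i, l).
  have /ffunP/(_ ((i, l), false)) := h0; rewrite !ffunE /= => /eqP.
  by rewrite subr_eq0 => /eqP.
have cst := @Zn_step_const n _ (fun l => h (i, l)) hc.
by apply: eq_opp0; rewrite -cell_alternating2 // [LHS]cst [RHS]cst.
Qed.

(** The value at the gradient of [delta] at the origin is the curl of the extension, which recovers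
    the parameters. *)
Lemma param_map_inj : lker (linfun param_map) == 0%VS.
Proof.
rewrite -subv0; apply/subvP=> u; rewrite memv_ker memv0 lfunE /= => /eqP u0.
have gB : grad (delta R (0, 0)) \in B by apply/cut_spaceP; exists (delta R (0, 0)).
have hA := alternating_extP u.
have := conv_mapE hA (vsprojK gB); rewrite -/(param_map u) u0 zero_lfunE conv_delta0.
move=> /esym/(curl_inj_alternating hA) E; apply/eqP/ffunP=> k.
by rewrite -alternating_ext_val E !ffunE.
Qed.

(** Counting the pairs by their larger coordinate gives a triangular sum. *)
Lemma card_half_triangle : #|{: {p | half_triangle p}}| = 'C(n %/ 2, 2).
Proof.
have m_le : (n %/ 2 <= (Zp_trunc n).+2)%N.
  by rewrite Zp_cast ?leq_div // (leq_trans _ n_ge5).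
rewrite card_sig -triangular_sum big_mkord.
rewrite (big_ord_widen _ (fun j : nat => j) m_le) -sum1_card.
transitivity (\sum_(j : 'Z_n) \sum_(i : 'Z_n) ((i < j < n %/ 2)%N : nat))%N.
  rewrite exchange_big pair_bigA /= big_mkcond /=; apply: eq_bigr => p _.
  by rewrite -[p \in _]/(p.1 < p.2 < n %/ 2)%N; case: (_ < _ < _)%N.
rewrite [RHS]big_mkcond; apply: eq_bigr => j _; case: ifP => jm /=; last first.
  by rewrite big1 // => i _; rewrite andbF.
rewrite -[RHS]subn0 -[RHS]muln1 -[RHS]sum_nat_const_nat big_mkord.
rewrite (big_ord_widen _ (fun=> 1%N) (ltnW (ltn_ord j))) [RHS]big_mkcond.
by apply: eq_bigr => i _; rewrite andbT; case: ltnP.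
Qed.

Lemma dim_param_map : \dim (limg (linfun param_map)) = (n %/ 2 * (n %/ 2 - 1) %/ 2)%N.
Proof.
rewrite limg_dim_eq; last by rewrite (eqP param_map_inj) capv0.
by rewrite dimvf /dim /= muln1 card_half_triangle bin2 !divn2 subn1.
Qed.

Lemma mem_param_map A : A \in limg (linfun param_map) <-> invariant_map A.
Proof.
split=> [/memv_imgP[u _ ->]|/invariant_map_conv[h hA ->]].
  by rewrite lfunE; apply/(conv_map_invariant n_ge5)/alternating_extP.
have [u ->] := alternating_ext_surj hA.
by rewrite -[conv_map _](lfunE param_map) memv_img ?memvf.
Qed.

End Parametrisation.

(** * Invariant projections correspond to invariant maps *)

Section Projections.
Import GRing.Theory.
Local Open Scope ring_scope.
Variables (R : realType) (n : nat).
Local Notation efun := (edge_space R n).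
Local Notation Z := (cycle_space R n).
Local Notation B := (cut_space R n).
Implicit Types (F : efun) (A : cut_to_cycle R n) (P : 'End(efun)).

Lemma projection_of_map_uniq A P P' :
  projection_of_map A P -> projection_of_map A P' -> P = P'.
Proof.
move=> PA P'A; apply/lfunP=> F; have [z [b ->]] := cycle_cut_dec F.
by rewrite PA P'A.
Qed.

Lemma map_of_projection_uniq A A' P :
  projection_of_map A P -> projection_of_map A' P -> A = A'.
Proof.
move=> PA PA'; apply/lfunP=> b; apply: subvs_inj.
by apply: (addrI (vsval (0 : subvs_of Z))); rewrite -PA -PA'.
Qed.

Lemma projection_of_map_exists A : exists P, projection_of_map A P.
Proof.
pose pB := daddv_pi B Z.
have BZ0 : (B :&: Z = 0)%VS by rewrite capvC cycle_cut_cap.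
(* [pB] projects onto cuts along cycles; comparing the two components of a cycle shows that it
   vanishes there. *)
have pBZ z : z \in Z -> pB z = 0.
  move=> zZ; have : z \in (B + Z)%VS by rewrite -[z]add0r memv_add ?mem0v.
  move/(daddv_pi_add BZ0); rewrite (daddv_pi_id (cycle_cut_cap R n) zZ).
  by move/eqP; rewrite -subr_eq0 addrK => /eqP.
exists (\1 - pB + (linfun vsval \o (A \o (linfun (vsproj B) \o pB))))%VF => z b.
rewrite !(add_lfunE, opp_lfunE, id_lfunE, comp_lfunE, lfunE) /= linearD /=.
rewrite pBZ ?subvsP // add0r (daddv_pi_id BZ0) ?subvsP // vsvalK.
by rewrite addrK.
Qed.

(** An isometry preserves both summands, so commutation can be checked on each. *)
Lemma projection_of_map_invariant A P : invariant_map A ->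
  projection_of_map A P -> invariant_projection_onto_cycles P.
Proof.
move=> Ainv PA.
have PZ z : z \in Z -> P z = z.
  move=> zZ; have := PA (Subvs zZ) 0; rewrite !linear0 /= !addr0.
  by [].
have Pim F : P F \in Z.
  by have [z [b ->]] := cycle_cut_dec F; rewrite PA memvD ?subvsP.
split=> [||g gI].
- by apply/lfunP=> F; rewrite comp_lfunE PZ.
- apply/eqP; rewrite eqEsubv; apply/andP; split; apply/subvP=> F.
    by case/memv_imgP=> G _ ->.
  by move=> FZ; rewrite -(PZ _ FZ) memv_img ?memvf.
apply/lfunP=> F; have [z [b ->]] := cycle_cut_dec F.
have gz := isometry_cycle gI (subvsP z); have gb := isometry_cut gI (subvsP b).
have E := PA (vsproj Z (g (vsval z))) (vsproj B (g (vsval b))).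
rewrite !vsprojK // Ainv // in E.
by rewrite !comp_lfunE PA !(linearD g) E.
Qed.

Lemma map_of_projection P : invariant_projection_onto_cycles P ->
  exists2 A, invariant_map A & projection_of_map A P.
Proof.
case=> PP imP Pg.
have Pim F : P F \in Z by rewrite -imP memv_img ?memvf.
have PZ z : z \in Z -> P z = z.
  by rewrite -imP => /memv_imgP[F _ ->]; rewrite -comp_lfunE PP.
(* The map is the restriction of [P] to cuts. *)
pose A : cut_to_cycle R n := (linfun (vsproj Z) \o (P \o linfun vsval))%VF.
have AE b : vsval (A b) = P (vsval b).
  by rewrite !comp_lfunE !lfunE /= vsprojK.
exists A => [g gI b|z b]; last first.
  by rewrite linearD /= AE (PZ (vsval z)) ?subvsP.
rewrite !AE vsprojK ?isometry_cut ?subvsP //.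
by rewrite -comp_lfunE (Pg _ gI) comp_lfunE.
Qed.
End Projections.

Theorem theorem24 (R : realType) (n : nat) (n_ge5 : (5 <= n)%N) :
  [/\ (forall A : cut_to_cycle R n, invariant_map A ->
         exists2 P, invariant_projection_onto_cycles P
                  & unique (projection_of_map A) P),
      (forall P : 'End(edge_space R n), invariant_projection_onto_cycles P ->
         exists2 A, invariant_map A
                  & unique (fun A' => projection_of_map A' P) A)
    & exists U : {vspace cut_to_cycle R n},
        (forall A, A \in U <-> invariant_map A) /\
        \dim U = (n %/ 2 * (n %/ 2 - 1)) %/ 2].
Proof.
split=> [A Ainv|P Pinv|].
- have [P PA] := projection_of_map_exists A.
  exists P; first exact: projection_of_map_invariant PA.
  by split=> // P'; exact: projection_of_map_uniq.
- have [A Ainv PA] := map_of_projection Pinv; exists A => //.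
  by split=> // A'; exact: map_of_projection_uniq.
exists (limg (linfun (@param_map R n))); split=> [A|]; last exact: dim_param_map.
exact: mem_param_map.
Qed.
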